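(* Let $\mathcal{T}$ be a monoidal triangulated category equipped with a compatible bounded t-structure $\mathbbm{t}$, and let $\mathcal{K}$ be a triangulated module category over $\mathcal{T}$ endowed with a bounded t-structure $\mathbbm{t}'$. Suppose that the module product bifunctor is compatible with $\mathbbm{t}$ and $\mathbbm{t}'$. Then for objects $X\in\mathcal{T}$, $M\in\mathcal{K}$ and an integer $n$, there is a natural isomorphism $$H^n_{\mathbbm{t}'}(X\otimes M)\cong\coprod_{p+q=n}H^p_{\mathbbm{t}}(X)\otimes H^q_{\mathbbm{t}'}(M).$$
   Context: A monoidal triangulated category is a triangulated category $\mathcal{T}$ with a monoidal structure whose tensor product is exact (triangulated) in each variable. A (left) triangulated module category over $\mathcal{T}$ is a triangulated category $\mathcal{K}$ with a left $\mathcal{T}$-module category structure (a module product bifunctor $\otimes:\mathcal{T}\times\mathcal{K}\to\mathcal{K}$ with natural associativity and unit isomorphisms satisfying the usual pentagon and triangle axioms) such that $\otimes$ is exact (triangulated) in both variables. For a t-structure $\mathbbm{t}=(\mathcal{K}^{\le0},\mathcal{K}^{\ge0})$ put $\mathcal{K}^{\le n}=\mathcal{K}^{\le0}[-n]$, $\mathcal{K}^{\ge n}=\mathcal{K}^{\ge0}[-n]$. It is bounded if $\bigcup_n\mathcal{K}^{\le n}=\bigcup_n\mathcal{K}^{\ge n}=\mathcal{K}$. Its heart is $\mathcal{H}_{\mathbbm{t}}=\mathcal{K}^{\le0}\cap\mathcal{K}^{\ge0}$, its truncation functors are $\tau_{\le n},\tau_{\ge n}$, and its cohomology functors are $H^0_{\mathbbm{t}}=\tau_{\le0}\tau_{\ge0}$,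 $H^n_{\mathbbm{t}}(X)=H^0_{\mathbbm{t}}(X[n])$. A t-structure $\mathbbm{t}$ on $\mathcal{T}$ is compatible (with the tensor product) if $\mathcal{H}_{\mathbbm{t}}\otimes\mathcal{H}_{\mathbbm{t}}\subseteq\mathcal{H}_{\mathbbm{t}}$. If $\mathbbm{t}$ is compatible and $\mathbbm{t}'$ is a t-structure on $\mathcal{K}$, the module product bifunctor is compatible with $\mathbbm{t}$ and $\mathbbm{t}'$ if $\mathcal{H}_{\mathbbm{t}}\otimes\mathcal{H}_{\mathbbm{t}'}\subseteq\mathcal{H}_{\mathbbm{t}'}$. (Here $\mathbbm{t},\mathbbm{t}'$ are just symbols naming t-structures.) *)

(* Defs.v *)
From mathcomp Require Import all_boot all_algebra.
From mathcomp Require Import boolp.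

Set Implicit Arguments.
Unset Strict Implicit.
Unset Printing Implicit Defensive.

Import GRing.Theory.
Local Open Scope ring_scope.

(* Morphism groups are [zmodType]s; the choice structure this carries is
   available on any type by classical choice. *)
Record precategory := PreCategory {
  obj :> Type;
  hom : obj -> obj -> zmodType;
  idm : forall X, hom X X;
  comp : forall X Y Z, hom Y Z -> hom X Y -> hom X Z;
  compA : forall X Y Z W (h : hom Z W) (g : hom Y Z) (f : hom X Y),
    comp h (comp g f) = comp (comp h g) f;
  comp1m : forall X Y (f : hom X Y), comp (idm Y) f = f;
  compm1 : forall X Y (f : hom X Y), comp f (idm X) = f;
  compDl : forall X Y Z (g g' : hom Y Z) (f : hom X Y),
    comp (g + g') f = comp g f + comp g' f;
  compDr : forall X Y Z (g : hom Y Z) (f f' : hom X Y),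
    comp g (f + f') = comp g f + comp g f' }.

Arguments hom {_} _ _.
Arguments idm {_} _.
Arguments comp {_ _ _ _} _ _.

Declare Scope cat_scope.
Delimit Scope cat_scope with cat.
Notation "g \oc f" := (comp g f) (at level 40, left associativity) : cat_scope.
Local Open Scope cat_scope.

#[local] Obligation Tactic := idtac.

Definition is_iso (C : precategory) (X Y : C) (f : hom X Y) : Prop :=
  exists g : hom Y X, g \oc f = idm X /\ f \oc g = idm Y.

Definition isomorphic (C : precategory) (X Y : C) : Prop :=
  exists f : hom X Y, is_iso f.

Definition iso_closed (C : precategory) (P : C -> Prop) : Prop :=
  forall X Y : C, isomorphic X Y -> P X -> P Y.

Definition is_zero (C : precategory) (Z : C) : Prop :=
  forall X : C, (forall f : hom X Z, f = 0) /\ (forall f : hom Z X, f = 0).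

(* Functors are not required to be additive; additivity is imposed where
   it is part of a definition. *)
Record functor (C D : precategory) := Functor {
  fobj :> C -> D;
  fmap : forall X Y, hom X Y -> hom (fobj X) (fobj Y);
  fmap1 : forall X, fmap (idm X) = idm (fobj X);
  fmapM : forall X Y Z (g : hom Y Z) (f : hom X Y),
    fmap (g \oc f) = fmap g \oc fmap f }.

Arguments fmap {_ _} _ {_ _} _.

Definition additive_functor (C D : precategory) (F : functor C D) : Prop :=
  forall (X Y : C) (f f' : hom X Y), fmap F (f + f') = fmap F f + fmap F f'.

Program Definition idF (C : precategory) : functor C C :=
  @Functor C C (fun X => X) (fun X Y f => f) _ _.
Next Obligation. by []. Qed.
Next Obligation. by []. Qed.

Program Definition compF (C D E : precategory) (G : functor D E)
    (F : functor C D) : functor C E :=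
  @Functor C E (fun X => G (F X)) (fun X Y f => fmap G (fmap F f)) _ _.
Next Obligation. by move=> * /=; rewrite !fmap1. Qed.
Next Obligation. by move=> * /=; rewrite !fmapM. Qed.

Record nat_iso (C D : precategory) (F G : functor C D) := NatIso {
  ni :> forall X, hom (F X) (G X);
  ni_iso : forall X, is_iso (ni X);
  ni_nat : forall X Y (f : hom X Y), fmap G f \oc ni X = ni Y \oc fmap F f }.

Record bifunctor (C D E : precategory) := Bifunctor {
  bobj :> C -> D -> E;
  bmap : forall X X' Y Y',
    hom X X' -> hom Y Y' -> hom (bobj X Y) (bobj X' Y');
  bmap1 : forall X Y, bmap (idm X) (idm Y) = idm (bobj X Y);
  bmapM : forall X X' X'' Y Y' Y'' (f' : hom X' X'') (f : hom X X')
      (g' : hom Y' Y'') (g : hom Y Y'),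
    bmap (f' \oc f) (g' \oc g) = bmap f' g' \oc bmap f g }.

Arguments bmap {_ _ _} _ {_ _ _ _} _ _.

Record binat_iso (C D E : precategory) (F G : bifunctor C D E) := BinatIso {
  bni :> forall X Y, hom (F X Y) (G X Y);
  bni_iso : forall X Y, is_iso (bni X Y);
  bni_nat : forall X X' Y Y' (f : hom X X') (g : hom Y Y'),
    bmap G f g \oc bni X Y = bni X' Y' \oc bmap F f g }.

Program Definition postB (C D E E' : precategory) (H : functor E E')
    (B : bifunctor C D E) : bifunctor C D E' :=
  @Bifunctor C D E' (fun X Y => H (B X Y))
    (fun X X' Y Y' f g => fmap H (bmap B f g)) _ _.
Next Obligation. by move=> * /=; rewrite bmap1 fmap1. Qed.
Next Obligation. by move=> * /=; rewrite bmapM fmapM. Qed.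

Program Definition preB (C C' D D' E : precategory) (B : bifunctor C' D' E)
    (F : functor C C') (G : functor D D') : bifunctor C D E :=
  @Bifunctor C D E (fun X Y => B (F X) (G Y))
    (fun X X' Y Y' f g => bmap B (fmap F f) (fmap G g)) _ _.
Next Obligation. by move=> * /=; rewrite !fmap1 bmap1. Qed.
Next Obligation. by move=> * /=; rewrite !fmapM bmapM. Qed.

Record coproduct (C : precategory) (I : Type) (F : I -> C) := Coproduct {
  cop :> C;
  inj : forall i, hom (F i) cop;
  copair : forall Z : C, (forall i, hom (F i) Z) -> hom cop Z;
  copairK : forall (Z : C) (g : forall i, hom (F i) Z) i,
    copair g \oc inj i = g i;
  copair_uniq : forall (Z : C) (h h' : hom cop Z),
    (forall i, h \oc inj i = h' \oc inj i) -> h = h' }.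

Program Definition coprodB (C D E : precategory) (I : Type)
    (F : I -> bifunctor C D E)
    (S : forall X Y, coproduct (fun i => F i X Y)) : bifunctor C D E :=
  @Bifunctor C D E (fun X Y => S X Y)
    (fun X X' Y Y' f g =>
       copair (S X Y) (fun i => inj (S X' Y') i \oc bmap (F i) f g)) _ _.
Next Obligation.
move=> C D E I F S X Y /=; apply: (copair_uniq (c := S X Y)) => i.
by rewrite (copairK (S X Y)) bmap1 compm1 comp1m.
Qed.
Next Obligation.
move=> C D E I F S X X' X'' Y Y' Y'' f' f g' g /=.
apply: (copair_uniq (c := S X Y)) => i.
rewrite (copairK (S X Y)) -[RHS]compA (copairK (S X Y)).
by rewrite compA (copairK (S X' Y')) bmapM compA.
Qed.

Arguments coprodB {_ _ _ _} F S.

Record additive_category := AdditiveCategory {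
  add_cat :> precategory;
  has_zero : exists Z : add_cat, is_zero Z;
  has_biproducts : forall X Y : add_cat, exists (S : add_cat)
      (i1 : hom X S) (i2 : hom Y S) (p1 : hom S X) (p2 : hom S Y),
    [/\ p1 \oc i1 = idm X, p2 \oc i2 = idm Y, p2 \oc i1 = 0, p1 \oc i2 = 0
      & i1 \oc p1 + i2 \oc p2 = idm S] }.

(* The shift is an additive auto-equivalence, not necessarily a strict
   automorphism; [unshift] is a chosen quasi-inverse. *)
Record triangulated_category := TriangulatedCategory {
  tri_cat :> additive_category;
  shift : functor tri_cat tri_cat;
  unshift : functor tri_cat tri_cat;
  shift_additive : additive_functor shift;
  shiftK : nat_iso (compF unshift shift) (idF tri_cat);
  unshiftK : nat_iso (compF shift unshift) (idF tri_cat);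
  dist : forall X Y Z : tri_cat,
    hom X Y -> hom Y Z -> hom Z (shift X) -> Prop;
  dist_iso : forall (X Y Z X' Y' Z' : tri_cat)
      (f : hom X Y) (g : hom Y Z) (h : hom Z (shift X))
      (f' : hom X' Y') (g' : hom Y' Z') (h' : hom Z' (shift X'))
      (a : hom X X') (b : hom Y Y') (c : hom Z Z'),
    is_iso a -> is_iso b -> is_iso c ->
    b \oc f = f' \oc a -> c \oc g = g' \oc b -> fmap shift a \oc h = h' \oc c ->
    dist f g h -> dist f' g' h';
  dist_id : forall X Z : tri_cat, is_zero Z ->
    dist (idm X) (0 : hom X Z) (0 : hom Z (shift X));
  dist_cone : forall (X Y : tri_cat) (f : hom X Y),
    exists (Z : tri_cat) (g : hom Y Z) (h : hom Z (shift X)), dist f g h;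
  dist_rot : forall (X Y Z : tri_cat)
      (f : hom X Y) (g : hom Y Z) (h : hom Z (shift X)),
    dist f g h <-> dist g h (- fmap shift f);
  dist_morph : forall (X Y Z X' Y' Z' : tri_cat)
      (f : hom X Y) (g : hom Y Z) (h : hom Z (shift X))
      (f' : hom X' Y') (g' : hom Y' Z') (h' : hom Z' (shift X'))
      (a : hom X X') (b : hom Y Y'),
    dist f g h -> dist f' g' h' -> b \oc f = f' \oc a ->
    exists c : hom Z Z',
      c \oc g = g' \oc b /\ fmap shift a \oc h = h' \oc c;
  dist_octa : forall (X Y Z X' Y' Z' : tri_cat)
      (f : hom X Y) (a : hom Y Z') (b : hom Z' (shift X))
      (g : hom Y Z) (c : hom Z X') (d : hom X' (shift Y))
      (e : hom Z Y') (k : hom Y' (shift X)),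
    dist f a b -> dist g c d -> dist (g \oc f) e k ->
    exists (u : hom Z' Y') (v : hom Y' X'),
      [/\ dist u v (fmap shift a \oc d), u \oc a = e \oc g, k \oc u = b,
          v \oc e = c & d \oc v = fmap shift f \oc k] }.

Arguments shift {_}.
Arguments unshift {_}.
Arguments dist {_ _ _ _} _ _ _.

Fixpoint iterF (C : precategory) (F : functor C C) (n : nat) : functor C C :=
  if n is n'.+1 then compF F (iterF F n') else idF C.

Definition shiftz (C : triangulated_category) (n : int) : functor C C :=
  match n with
  | Posz k => iterF shift k
  | Negz k => iterF unshift k.+1
  end.

Arguments shiftz {_} n.

(* A bifunctor that is triangulated in each variable: the comparison
   isomorphisms with the shift are natural in both variables.  Their
   anticommutation on a double shift is not part of the definition. *)
Record exact_bifunctor (C D E : triangulated_category) := ExactBifunctor {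
  eb_bif :> bifunctor C D E;
  eb_addl : forall (X X' : C) (Y Y' : D) (f f' : hom X X') (g : hom Y Y'),
    bmap eb_bif (f + f') g = bmap eb_bif f g + bmap eb_bif f' g;
  eb_addr : forall (X X' : C) (Y Y' : D) (f : hom X X') (g g' : hom Y Y'),
    bmap eb_bif f (g + g') = bmap eb_bif f g + bmap eb_bif f g';
  eb_shl : binat_iso (preB eb_bif shift (idF D)) (postB shift eb_bif);
  eb_shr : binat_iso (preB eb_bif (idF C) shift) (postB shift eb_bif);
  eb_distl : forall (X X' X'' : C) (f : hom X X') (g : hom X' X'')
      (h : hom X'' (shift X)) (Y : D),
    dist f g h ->
    dist (bmap eb_bif f (idm Y)) (bmap eb_bif g (idm Y))
         (eb_shl X Y \oc bmap eb_bif h (idm Y));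
  eb_distr : forall (X : C) (Y Y' Y'' : D) (f : hom Y Y') (g : hom Y' Y'')
      (h : hom Y'' (shift Y)),
    dist f g h ->
    dist (bmap eb_bif (idm X) f) (bmap eb_bif (idm X) g)
         (eb_shr X Y \oc bmap eb_bif (idm X) h) }.

Record monoidal_triangulated := MonoidalTriangulated {
  mt_cat :> triangulated_category;
  tens : exact_bifunctor mt_cat mt_cat mt_cat;
  unit_obj : mt_cat;
  assoc : forall X Y Z : mt_cat, hom (tens (tens X Y) Z) (tens X (tens Y Z));
  lunit : forall X : mt_cat, hom (tens unit_obj X) X;
  runit : forall X : mt_cat, hom (tens X unit_obj) X;
  assoc_iso : forall X Y Z, is_iso (assoc X Y Z);
  lunit_iso : forall X, is_iso (lunit X);
  runit_iso : forall X, is_iso (runit X);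
  assoc_nat : forall (X X' Y Y' Z Z' : mt_cat)
      (f : hom X X') (g : hom Y Y') (h : hom Z Z'),
    bmap tens f (bmap tens g h) \oc assoc X Y Z =
    assoc X' Y' Z' \oc bmap tens (bmap tens f g) h;
  lunit_nat : forall (X X' : mt_cat) (f : hom X X'),
    f \oc lunit X = lunit X' \oc bmap tens (idm unit_obj) f;
  runit_nat : forall (X X' : mt_cat) (f : hom X X'),
    f \oc runit X = runit X' \oc bmap tens f (idm unit_obj);
  tens_pentagon : forall W X Y Z : mt_cat,
    bmap tens (idm W) (assoc X Y Z) \oc assoc W (tens X Y) Z
      \oc bmap tens (assoc W X Y) (idm Z) =
    assoc W X (tens Y Z) \oc assoc (tens W X) Y Z;
  tens_triangle : forall X Y : mt_cat,
    bmap tens (idm X) (lunit Y) \oc assoc X unit_obj Y =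
    bmap tens (runit X) (idm Y) }.

Record module_category (T : monoidal_triangulated) := ModuleCategory {
  mod_cat :> triangulated_category;
  act : exact_bifunctor T mod_cat mod_cat;
  act_assoc : forall (X Y : T) (M : mod_cat),
    hom (act (tens T X Y) M) (act X (act Y M));
  act_unit : forall M : mod_cat, hom (act (unit_obj T) M) M;
  act_assoc_iso : forall X Y M, is_iso (act_assoc X Y M);
  act_unit_iso : forall M, is_iso (act_unit M);
  act_assoc_nat : forall (X X' Y Y' : T) (M M' : mod_cat)
      (f : hom X X') (g : hom Y Y') (h : hom M M'),
    bmap act f (bmap act g h) \oc act_assoc X Y M =
    act_assoc X' Y' M' \oc bmap act (bmap (tens T) f g) h;
  act_unit_nat : forall (M M' : mod_cat) (f : hom M M'),
    f \oc act_unit M = act_unit M' \oc bmap act (idm (unit_obj T)) f;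
  act_pentagon : forall (X Y Z : T) (M : mod_cat),
    bmap act (idm X) (act_assoc Y Z M) \oc act_assoc X (tens T Y Z) M
      \oc bmap act (assoc X Y Z) (idm M) =
    act_assoc X Y (act Z M) \oc act_assoc (tens T X Y) Z M;
  act_triangle : forall (X : T) (M : mod_cat),
    bmap act (idm X) (act_unit M) \oc act_assoc X (unit_obj T) M =
    bmap act (runit X) (idm M) }.

(* For a full subcategory P, the subcategory P[n], closed under isomorphism. *)
Definition shifted (C : triangulated_category) (P : C -> Prop) (n : int)
    (X : C) : Prop :=
  exists2 Y : C, P Y & isomorphic X (shiftz n Y).

Record tstructure (C : triangulated_category) := TStructure {
  le0 : C -> Prop;
  ge0 : C -> Prop;
  le0_iso : iso_closed le0;
  ge0_iso : iso_closed ge0;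
  le0_le1 : forall X, le0 X -> shifted le0 (-1) X;
  ge1_ge0 : forall X, shifted ge0 (-1) X -> ge0 X;
  le0_ge1_hom : forall (X Y : C) (f : hom X Y),
    le0 X -> shifted ge0 (-1) Y -> f = 0;
  le0_ge1_dist : forall X : C, exists (A B : C)
      (i : hom A X) (p : hom X B) (d : hom B (shift A)),
    [/\ le0 A, shifted ge0 (-1) B & dist i p d] }.

Definition leN (C : triangulated_category) (t : tstructure C) (n : int) :
  C -> Prop := shifted (le0 t) (- n).

Definition geN (C : triangulated_category) (t : tstructure C) (n : int) :
  C -> Prop := shifted (ge0 t) (- n).

Definition bounded (C : triangulated_category) (t : tstructure C) : Prop :=
  (forall X, exists n : int, leN t n X) /\ (forall X, exists n : int, geN t n X).

Definition heart (C : triangulated_category) (t : tstructure C) (X : C) : Prop :=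
  le0 t X /\ ge0 t X.

Definition compatible (T : monoidal_triangulated) (t : tstructure T) : Prop :=
  forall X Y : T, heart t X -> heart t Y -> heart t (tens T X Y).

Definition act_compatible (T : monoidal_triangulated) (K : module_category T)
    (t : tstructure T) (t' : tstructure K) : Prop :=
  forall (X : T) (M : K), heart t X -> heart t' M -> heart t' (act K X M).

(* Right and left adjoints to the inclusion of a full subcategory P,
   regarded as endofunctors of the ambient category. *)
Record coreflection (C : precategory) (P : C -> Prop) := Coreflection {
  cor_fun :> functor C C;
  cor_in : forall X, P (cor_fun X);
  cor_counit : forall X, hom (cor_fun X) X;
  cor_nat : forall X Y (f : hom X Y),
    f \oc cor_counit X = cor_counit Y \oc fmap cor_fun f;
  cor_univ : forall X A (f : hom A X), P A ->
    exists! g : hom A (cor_fun X), cor_counit X \oc g = f }.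

Record reflection (C : precategory) (P : C -> Prop) := Reflection {
  ref_fun :> functor C C;
  ref_in : forall X, P (ref_fun X);
  ref_unit : forall X, hom X (ref_fun X);
  ref_nat : forall X Y (f : hom X Y),
    fmap ref_fun f \oc ref_unit X = ref_unit Y \oc f;
  ref_univ : forall X B (f : hom X B), P B ->
    exists! g : hom (ref_fun X) B, g \oc ref_unit X = f }.

Lemma coreflection_pointwise (C : precategory) (P : C -> Prop) :
  (forall X : C, exists (A : C) (e : hom A X), P A /\
     forall A' (f : hom A' X), P A' -> exists! g : hom A' A, e \oc g = f) ->
  inhabited (coreflection P).
Proof.
move=> ex.
have {}ex X : {A : C & {e : hom A X | P A /\
    forall A' (f : hom A' X), P A' -> exists! g : hom A' A, e \oc g = f}}.
  by case: (cid (ex X)) => A /cid e; exists A.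
pose A X := projT1 (ex X).
pose e X : hom (A X) X := proj1_sig (projT2 (ex X)).
have PA X : P (A X) by case: (proj2_sig (projT2 (ex X))).
have univ X : forall A' (f : hom A' X), P A' ->
    exists! g : hom A' (A X), e X \oc g = f.
  by case: (proj2_sig (projT2 (ex X))).
have inje X A' (g g' : hom A' (A X)) : P A' -> e X \oc g = e X \oc g' -> g = g'.
  move=> PA' eq_g; case: (univ X A' (e X \oc g) PA') => h [_ hu].
  by rewrite -(hu g) // -(hu g').
pose m X Y (f : hom X Y) := cid (univ Y (A X) (f \oc e X) (PA X)).
have mE X Y (f : hom X Y) : e Y \oc proj1_sig (m X Y f) = f \oc e X.
  by case: (proj2_sig (m X Y f)).
have m1 X : proj1_sig (m X X (idm X)) = idm (A X).
  by apply: inje; rewrite // mE comp1m compm1.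
have mM X Y Z (g : hom Y Z) (f : hom X Y) : proj1_sig (m X Z (g \oc f)) =
    proj1_sig (m Y Z g) \oc proj1_sig (m X Y f).
  by apply: inje; rewrite // compA !mE -!compA mE.
constructor; apply: (@Coreflection C P (Functor m1 mM) PA e) => // X Y f.
by rewrite mE.
Qed.

Lemma reflection_pointwise (C : precategory) (P : C -> Prop) :
  (forall X : C, exists (B : C) (e : hom X B), P B /\
     forall B' (f : hom X B'), P B' -> exists! g : hom B B', g \oc e = f) ->
  inhabited (reflection P).
Proof.
move=> ex.
have {}ex X : {B : C & {e : hom X B | P B /\
    forall B' (f : hom X B'), P B' -> exists! g : hom B B', g \oc e = f}}.
  by case: (cid (ex X)) => B /cid e; exists B.
pose B X := projT1 (ex X).
pose e X : hom X (B X) := proj1_sig (projT2 (ex X)).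
have PB X : P (B X) by case: (proj2_sig (projT2 (ex X))).
have univ X : forall B' (f : hom X B'), P B' ->
    exists! g : hom (B X) B', g \oc e X = f.
  by case: (proj2_sig (projT2 (ex X))).
have epie X B' (g g' : hom (B X) B') : P B' -> g \oc e X = g' \oc e X -> g = g'.
  move=> PB' eq_g; case: (univ X B' (g \oc e X) PB') => h [_ hu].
  by rewrite -(hu g) // -(hu g').
pose m X Y (f : hom X Y) := cid (univ X (B Y) (e Y \oc f) (PB Y)).
have mE X Y (f : hom X Y) : proj1_sig (m X Y f) \oc e X = e Y \oc f.
  by case: (proj2_sig (m X Y f)).
have m1 X : proj1_sig (m X X (idm X)) = idm (B X).
  by apply: epie; rewrite // mE comp1m compm1.
have mM X Y Z (g : hom Y Z) (f : hom X Y) : proj1_sig (m X Z (g \oc f)) =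
    proj1_sig (m Y Z g) \oc proj1_sig (m X Y f).
  by apply: epie; rewrite // -compA !mE !compA mE.
constructor; exact: (@Reflection C P (Functor m1 mM) PB e).
Qed.

Section Truncation.
Variables (C : triangulated_category).
Implicit Types X Y Z W : C.

Lemma comp0m X Y Z (f : hom X Y) : (0 : hom Y Z) \oc f = 0.
Proof. by apply: (addrI (0 \oc f)); rewrite -compDl !addr0. Qed.

Lemma compm0 X Y Z (g : hom Y Z) : g \oc (0 : hom X Y) = 0.
Proof. by apply: (addrI (g \oc 0)); rewrite -compDr !addr0. Qed.

Lemma compNm X Y Z (g : hom Y Z) (f : hom X Y) : (- g) \oc f = - (g \oc f).
Proof. by apply: (addrI (g \oc f)); rewrite -compDl !subrr comp0m. Qed.

Lemma compmN X Y Z (g : hom Y Z) (f : hom X Y) : g \oc (- f) = - (g \oc f).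
Proof. by apply: (addrI (g \oc f)); rewrite -compDr !subrr compm0. Qed.

Lemma fmap_shift0 X Y : fmap shift (0 : hom X Y) = 0.
Proof.
apply: (addrI (fmap shift (0 : hom X Y))).
by rewrite -shift_additive !addr0.
Qed.

Lemma is_zero_shift Z : is_zero Z -> is_zero (shift Z).
Proof.
move=> zZ; have id0 : idm (shift Z) = 0.
  by rewrite -fmap1 (proj1 (zZ Z) (idm Z)) fmap_shift0.
by move=> V; split=> k; [rewrite -(comp1m k) | rewrite -(compm1 k)];
  rewrite id0 ?comp0m ?compm0.
Qed.

Lemma dist_weak_coker X Y Z (f : hom X Y) (g : hom Y Z) h W (w : hom Y W) :
  dist f g h -> w \oc f = 0 -> exists v : hom Z W, v \oc g = w.
Proof.
move=> dfg wf0; have [O zO] := has_zero C.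
have d0 : dist (0 : hom O W) (idm W) (0 : hom W (shift O)).
  apply/dist_rot; rewrite fmap_shift0 oppr0.
  exact/dist_id/is_zero_shift.
have [|v [vE _]] := dist_morph (a := 0 : hom X O) (b := w) dfg d0.
  by rewrite wf0 compm0.
by exists v; rewrite vE comp1m.
Qed.

Lemma shift_inj X Y (f f' : hom X Y) : fmap shift f = fmap shift f' -> f = f'.
Proof.
move=> eq_f; have [g [_ gK]] := ni_iso (@shiftK C) X.
have E := ni_nat (@shiftK C); rewrite /= in E.
by rewrite -(compm1 f) -(compm1 f') -gK !compA !E eq_f.
Qed.

Lemma unshift_inj X Y (f f' : hom X Y) :
  fmap unshift f = fmap unshift f' -> f = f'.
Proof.
move=> eq_f; have [g [_ gK]] := ni_iso (@unshiftK C) X.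
have E := ni_nat (@unshiftK C); rewrite /= in E.
by rewrite -(compm1 f) -(compm1 f') -gK !compA !E eq_f.
Qed.

Lemma shift_full X Y (c : hom (shift X) (shift Y)) :
  exists v : hom X Y, fmap shift v = c.
Proof.
pose e Z : hom (unshift (shift Z)) Z := shiftK C Z.
have eN Z Z' (f : hom Z Z') :
    f \oc e Z = e Z' \oc fmap unshift (fmap shift f) := ni_nat (shiftK C) f.
have isoe Z : is_iso (e Z) := ni_iso (shiftK C) Z.
have [[gX [gXK _]] [gY [gYK _]]] := (isoe X, isoe Y).
exists (e Y \oc fmap unshift c \oc gX); apply: unshift_inj.
set v := _ \oc gX; rewrite -[LHS]comp1m -gYK -compA -eN /v.
by rewrite -[_ \oc e X]compA gXK compm1 compA gYK comp1m.
Qed.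

Lemma dist_weak_ker X Y Z (f : hom X Y) (g : hom Y Z) h W (w : hom W Y) :
  dist f g h -> g \oc w = 0 -> exists v : hom W X, f \oc v = w.
Proof.
move=> /dist_rot dfg gw0; have [O zO] := has_zero C.
have /dist_rot d0 := dist_id W zO.
have [|c [_]] := dist_morph (a := w) (b := 0 : hom O Z) d0 dfg.
  by rewrite gw0 compm0.
rewrite fmap1 compmN compm1 compNm => /oppr_inj cE.
have [v vE] := shift_full c; exists v.
by apply: shift_inj; rewrite fmapM vE.
Qed.

Lemma is_iso_comp X Y Z (g : hom Y Z) (f : hom X Y) :
  is_iso g -> is_iso f -> is_iso (g \oc f).
Proof.
move=> [g' [g'K gK]] [f' [f'K fK]]; exists (f' \oc g'); split.
  by rewrite compA -(compA f') g'K compm1.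
by rewrite compA -(compA g) fK compm1.
Qed.

Lemma is_iso_shift X Y (f : hom X Y) : is_iso f -> is_iso (fmap shift f).
Proof.
by case=> g [gK fK]; exists (fmap shift g); rewrite -!fmapM gK fK !fmap1.
Qed.

Lemma isomorphic_sym X Y : isomorphic X Y -> isomorphic Y X.
Proof. by case=> f [g [gK fK]]; exists g, f. Qed.

Lemma shifted_shift (P : C -> Prop) X :
  iso_closed P -> shifted P (-1) X -> P (shift X).
Proof.
move=> isoP [Y PY [f isof]]; apply: isoP PY; apply: isomorphic_sym.
exists (unshiftK C Y \oc fmap shift f).
by apply: is_iso_comp; [exact: (ni_iso (unshiftK C)) | exact: is_iso_shift].
Qed.

Variable t : tstructure C.

Lemma coreflection_le0 : inhabited (coreflection (le0 t)).
Proof.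
apply: coreflection_pointwise => X.
have [A [B [i [p [d [leA geB dX]]]]]] := le0_ge1_dist t X.
exists A, i; split=> // A' f leA'.
have [|g gE] := dist_weak_ker (w := f) dX; first exact: le0_ge1_hom leA' geB.
exists g; split=> // g' g'E; apply/eqP; rewrite -subr_eq0; apply/eqP.
have ig0 : i \oc (g - g') = 0 by rewrite compDr compmN gE g'E subrr.
have /dist_rot/dist_rot dX' := dX.
have [|k kE] := dist_weak_ker (w := fmap shift (g - g')) dX'.
  by rewrite compNm -fmapM ig0 fmap_shift0 oppr0.
apply: shift_inj; rewrite fmap_shift0 -kE.
rewrite (_ : k = 0) ?compm0 //; apply: le0_ge1_hom geB.
exact: shifted_shift (@le0_iso _ t) (le0_le1 leA').
Qed.

Lemma reflection_ge0 : inhabited (reflection (ge0 t)).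
Proof.
apply: reflection_pointwise => X.
have [A [B [i [p [d [leA geB]]]]]] := le0_ge1_dist t (unshift X).
move=> /dist_rot/dist_rot/dist_rot dX.
have hom0 A' Y (k : hom (shift A') Y) : le0 t A' -> ge0 t Y -> k = 0.
  move=> leA' geY; have [e [_ eK]] := ni_iso (unshiftK C) Y.
  have [v vE] := @shift_full A' (unshift Y) (e \oc k).
  rewrite -(comp1m k) -eK -compA -vE (_ : v = 0) ?fmap_shift0 ?compm0 //.
  apply: (le0_ge1_hom (t := t)) => //; exists Y => //.
  by exists (idm _), (idm _); rewrite !compm1.
have [e [eK Ke]] := ni_iso (unshiftK C) X.
exists (shift B), (- fmap shift p \oc e); split.
  exact: shifted_shift (@ge0_iso _ t) geB.
move=> Y f geY.
have [|g gE] := dist_weak_coker (w := f \oc unshiftK C X) dX.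
  exact: hom0 leA geY.
exists g; split; first by rewrite compA gE -compA Ke compm1.
move=> g' g'E; apply/eqP; rewrite -subr_eq0; apply/eqP.
have gp0 : (g - g') \oc (- fmap shift p) = 0.
  rewrite compDl gE compNm; apply/eqP; rewrite subr_eq0; apply/eqP.
  by rewrite -[RHS]compm1 -eK compA -(compA g') g'E.
have /dist_rot dX' := dX.
have [k <-] := dist_weak_coker dX' gp0.
rewrite (_ : k = 0) ?comp0m //; apply: hom0 geY.
exact: shifted_shift (@le0_iso _ t) (le0_le1 leA).
Qed.

(* Both are determined up to unique isomorphism by the adjunctions. *)
Definition tau_le0 : coreflection (le0 t) :=
  inhabited_witness coreflection_le0.

Definition tau_ge0 : reflection (ge0 t) :=
  inhabited_witness reflection_ge0.

Definition cohomology (n : int) : functor C C :=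
  compF (compF tau_le0 tau_ge0) (shiftz n).

End Truncation.

Definition cohomology_act (T : monoidal_triangulated) (K : module_category T)
    (t' : tstructure K) (n : int) : bifunctor T K K :=
  postB (cohomology t' n) (act K).

Definition act_cohomology (T : monoidal_triangulated) (K : module_category T)
    (t : tstructure T) (t' : tstructure K) (pq : int * int) : bifunctor T K K :=
  preB (act K) (cohomology t pq.1) (cohomology t' pq.2).

Definition bidegree (n : int) : Type := {pq : int * int | pq.1 + pq.2 == n}.

Definition kunneth_family (T : monoidal_triangulated) (K : module_category T)
    (t : tstructure T) (t' : tstructure K) (n : int) (pq : bidegree n) :
  bifunctor T K K := act_cohomology t t' (val pq).

Arguments kunneth_family {_ _} t t' n pq.

(* Main.v *)
From mathcomp Require Import all_boot all_order all_algebra.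
From mathcomp Require Import boolp zify.
Require Import Defs.

Set Implicit Arguments.
Unset Strict Implicit.
Unset Printing Implicit Defensive.

Import Order.TTheory GRing.Theory Num.Theory.
Local Open Scope ring_scope.
Local Open Scope cat_scope.

(** For [p + q = n] the truncations of [X[p]] and [M[q]] give a natural map from
    [tau_le0 X[p] (x) tau_le0 M[q]] to [X[p] (x) M[q]], which is [(X (x) M)[n]].
    Its source lies in [le0], and its top cohomology is [H^p X (x) H^q M]
    ([top_coh_act]), so on [H^0] it induces a natural map [kunneth_map] from
    [H^p X (x) H^q M] to [H^n (X (x) M)].  The theorem says that these maps
    exhibit [H^n (X (x) M)] as a coproduct; this yields at once the existence
    of the coproduct, the isomorphism and its naturality.

    By devissage along the two bounded t-structures, the compatibility of the
    hearts gives [le p (x) le q] in [le (p + q)] and [ge p (x) ge q] in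
    [ge (p + q)] ([act_leN], [act_geN]).  To see that the maps are jointly
    bijective, peel off the top cohomology of [X] in [le b] ([kunneth_decomp]):
    let [X' -> X -> G] be the triangle with [X'] in [le (b - 1)] and [G] in the
    heart shifted to degree [b].  The composite
    [X (x) tau_le(n - b) M -> X (x) M -> G (x) M] is bijective on [H^n], for the
    first factor of [X (x) tau_le(n - b) M -> G (x) tau_le(n - b) M -> G (x) M]
    has its fiber in [le (n - 1)] and the second its cone in [ge (n + 1)]
    ([top_slice_bij]).  So [H^n (X (x) M) -> H^n (G (x) M)] is split by the
    summand of index [b]; the same in degree [n - 1] kills the connecting map,
    so that [H^n (X' (x) M)] is the complement, to which induction applies.

    Exactness in the heart is handled without making the heart an abelian
    category.  An element of [H^m Y] is represented by a map [U -> Y] with [U]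
    in [le m], up to passing to a [cover] of [U], a map in [le m] that is an
    epimorphism on [H^m]; it is zero when it is [null].  With this reading the
    exactness of [H^m] at a triangle is the exactness of [hom U], and maps that
    are bijective on generalized elements are turned back into honest maps by
    descent along covers ([cover_descent], [H0_coproduct]). *)

(** * Natural isomorphisms and powers of the shift *)

Lemma int_updown (P : int -> Type) :
  P 0 -> (forall a, P a -> P (a + 1)) -> (forall a, P a -> P (a - 1)) ->
  forall a, P a.
Proof.
move=> P0 Pup Pdown; elim/int_rect => // k.
  by move/Pup; rewrite -PoszD addn1.
by move/Pdown; rewrite -opprD -PoszD addn1.
Qed.

Section Precategory.
Variable C : precategory.
Implicit Types X Y Z W : C.

Lemma is_iso_idm X : is_iso (idm X).
Proof. by exists (idm X); rewrite !comp1m. Qed.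

(** Pasting of commutative squares: naturality of a composite is checked one
    factor at a time. *)
Lemma square_comp X Y Z X' Y' Z' (u : hom X Y) (v : hom Y Z)
    (u' : hom X' Y') (v' : hom Y' Z')
    (f : hom X X') (g : hom Y Y') (h : hom Z Z') :
  g \oc u = u' \oc f -> h \oc v = v' \oc g ->
  h \oc (v \oc u) = (v' \oc u') \oc f.
Proof. by move=> gu hv; rewrite compA hv -compA gu compA. Qed.

Lemma is_iso_compose X Y Z (g : hom Y Z) (f : hom X Y) :
  is_iso g -> is_iso f -> is_iso (g \oc f).
Proof.
move=> [g' [g'K gK]] [f' [f'K fK]]; exists (f' \oc g'); split.
  by rewrite compA -(compA f') g'K compm1.
by rewrite compA -(compA g) fK compm1.
Qed.

Lemma isomorphic_trans X Y Z :
  isomorphic X Y -> isomorphic Y Z -> isomorphic X Z.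
Proof. by move=> [f fi] [g gi]; exists (g \oc f); exact: is_iso_compose. Qed.

Lemma iso_epi X Y Z (f : hom X Y) (g g' : hom Y Z) :
  is_iso f -> g \oc f = g' \oc f -> g = g'.
Proof.
by move=> [k [_ fK]] E; rewrite -(compm1 g) -(compm1 g') -fK !compA E.
Qed.

Lemma iso_mono X Y Z (f : hom Y Z) (g g' : hom X Y) :
  is_iso f -> f \oc g = f \oc g' -> g = g'.
Proof.
by move=> [k [fK _]] E; rewrite -(comp1m g) -(comp1m g') -fK -!compA E.
Qed.

End Precategory.

Lemma fmap_iso (C D : precategory) (F : functor C D) (X Y : C) (f : hom X Y) :
  is_iso f -> is_iso (fmap F f).
Proof.
by case=> g [gK fK]; exists (fmap F g); rewrite -!fmapM gK fK !fmap1.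
Qed.

Lemma bmap_iso (C D E : precategory) (B : bifunctor C D E) (X X' : C) (Y Y' : D)
    (f : hom X X') (g : hom Y Y') : is_iso f -> is_iso g -> is_iso (bmap B f g).
Proof.
move=> [f' [f'K fK]] [g' [g'K gK]]; exists (bmap B f' g').
by rewrite -!bmapM f'K fK g'K gK !bmap1.
Qed.

Section NatIso.
Variables C D E : precategory.

Lemma nat_iso_sym (F G : functor C D) : nat_iso F G -> nat_iso G F.
Proof.
move=> a; pose b X := projT1 (cid (ni_iso a X)).
have [ba ab] :
    (forall X, b X \oc a X = idm _) /\ (forall X, a X \oc b X = idm _).
  by split=> X; rewrite /b; case: cid => ? [].
apply: (@NatIso _ _ _ _ b) => [X|X Y f]; first by exists (a X).
apply: (iso_epi (f := a X)); first exact: ni_iso.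
by rewrite -!compA ni_nat ba compm1 compA ba comp1m.
Qed.

Lemma nat_iso_trans (F G H : functor C D) :
  nat_iso F G -> nat_iso G H -> nat_iso F H.
Proof.
move=> a b; refine (@NatIso _ _ F H (fun X => b X \oc a X) _ _) => [X|X Y f].
  by apply: is_iso_compose; exact: ni_iso.
by apply: square_comp; exact: ni_nat.
Qed.

Lemma nat_iso_post (H : functor D E) (F G : functor C D) :
  nat_iso F G -> nat_iso (compF H F) (compF H G).
Proof.
move=> a; refine (@NatIso _ _ (compF H F) (compF H G)
  (fun X => fmap H (a X)) _ _) => [X|X Y f] /=.
  exact/fmap_iso/ni_iso.
by rewrite -!fmapM ni_nat.
Qed.

Lemma nat_iso_pre (H : functor C D) (F G : functor D E) :
  nat_iso F G -> nat_iso (compF F H) (compF G H).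
Proof.
move=> a; refine (@NatIso _ _ (compF F H) (compF G H)
  (fun X => a (H X)) _ _) => [X|X Y f] /=.
  exact: ni_iso.
exact: ni_nat.
Qed.

End NatIso.

Lemma nat_iso_refl (C D : precategory) (F : functor C D) : nat_iso F F.
Proof.
refine (@NatIso _ _ F F (fun X => idm (F X)) _ _) => [X|X Y f].
  exact: is_iso_idm.
by rewrite compm1 comp1m.
Qed.

Lemma nat_iso_assoc (C D E E' : precategory) (F : functor E E')
    (G : functor D E) (H : functor C D) :
  nat_iso (compF (compF F G) H) (compF F (compF G H)).
Proof.
refine (@NatIso _ _ (compF (compF F G) H) (compF F (compF G H))
  (fun X => idm (F (G (H X)))) _ _) => [X|X Y f]; first exact: is_iso_idm.
by rewrite compm1 comp1m.
Qed.

Lemma quasi_inverse_faithful (C D : precategory) (F : functor C D)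
    (G : functor D C) : nat_iso (compF G F) (idF C) ->
  forall (X Y : C) (f f' : hom X Y), fmap F f = fmap F f' -> f = f'.
Proof.
move=> a X Y f f' eqf; apply: (@iso_epi _ (G (F X)) X Y (a X)).
  exact: (ni_iso a).
have E (h : hom X Y) : h \oc a X = a Y \oc fmap G (fmap F h) := ni_nat a h.
by rewrite !E eqf.
Qed.

Lemma quasi_inverse_full (C D : precategory) (F : functor C D)
    (G : functor D C) :
  nat_iso (compF G F) (idF C) -> nat_iso (compF F G) (idF D) ->
  forall (X Y : C) (c : hom (F X) (F Y)), exists f : hom X Y, fmap F f = c.
Proof.
move=> a b X Y c.
have [g [gK _]] : is_iso (a X : hom (G (F X)) X) := ni_iso a X.
have /= E (h : hom X Y) : h \oc a X = a Y \oc fmap G (fmap F h) := ni_nat a h.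
exists (a Y \oc fmap G c \oc g); apply: (quasi_inverse_faithful b).
apply: (@iso_mono _ _ _ Y (a Y)); first exact: (ni_iso a).
by move=> /=; rewrite -E -compA gK compm1.
Qed.

Section Powers.
Variable C : triangulated_category.
Implicit Types X Y Z W : C.

(** The definition of [shiftz] makes this an equality for nonnegative [a]; in
    negative degrees the new shift cancels the outermost [unshift]. *)
Lemma shiftz_succ (a : int) :
  nat_iso (@shiftz C (a + 1)) (compF shift (shiftz a)).
Proof.
case: a => [k|[|k]].
- by rewrite -PoszD addn1; exact: nat_iso_refl.
- apply: nat_iso_sym.
  refine (@NatIso _ _ (compF shift (shiftz (Negz 0))) (idF C)
    (fun X => unshiftK C X) _ _) => X.
    exact: (ni_iso (unshiftK C)).
  move=> Y f; exact: (ni_nat (unshiftK C)).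
- rewrite (_ : Negz k.+1 + 1 = Negz k); last by lia.
  apply: nat_iso_sym.
  refine (@NatIso _ _ (compF shift (shiftz (Negz k.+1))) (shiftz (Negz k))
    (fun X => unshiftK C _) _ _) => X.
    exact: (ni_iso (unshiftK C)).
  move=> Y f; exact: (ni_nat (unshiftK C)).
Qed.

Lemma shiftz_pred (a : int) :
  nat_iso (@shiftz C (a - 1)) (compF unshift (shiftz a)).
Proof.
have := nat_iso_post unshift (shiftz_succ (a - 1)); rewrite subrK => b.
apply: nat_iso_sym; apply: nat_iso_trans b _.
refine (@NatIso _ _ (compF unshift (compF shift (shiftz (a - 1))))
  (shiftz (a - 1)) (fun X => shiftK C (shiftz (a - 1) X)) _ _) => X.
  exact: (ni_iso (shiftK C)).
by move=> Y f; exact: (ni_nat (shiftK C)).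
Qed.

Lemma shiftz_comp (a b : int) :
  nat_iso (compF (shiftz a) (shiftz b)) (@shiftz C (a + b)).
Proof.
elim/int_updown: a => [|a IH|a IH].
- rewrite add0r; refine (@NatIso _ _ (compF (shiftz 0) (shiftz b)) (shiftz b)
    (fun X => idm (shiftz b X)) _ _) => X.
    exact: is_iso_idm.
  by move=> Y f; rewrite /= compm1 comp1m.
- rewrite addrAC; apply: nat_iso_trans (nat_iso_sym (shiftz_succ _)).
  apply: nat_iso_trans (nat_iso_pre _ (shiftz_succ a)) _.
  by apply: nat_iso_trans (nat_iso_assoc _ _ _) _; exact: nat_iso_post IH.
- rewrite addrAC; apply: nat_iso_trans (nat_iso_sym (shiftz_pred _)).
  apply: nat_iso_trans (nat_iso_pre _ (shiftz_pred a)) _.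
  by apply: nat_iso_trans (nat_iso_assoc _ _ _) _; exact: nat_iso_post IH.
Qed.

Lemma shiftzNK (a : int) : nat_iso (compF (shiftz (- a)) (shiftz a)) (idF C).
Proof. by have := shiftz_comp (- a) a; rewrite addNr. Qed.

Lemma shiftzKN (a : int) : nat_iso (compF (shiftz a) (shiftz (- a))) (idF C).
Proof. by have := shiftz_comp a (- a); rewrite addrN. Qed.

Lemma shiftz_inj (a : int) X Y (f f' : hom X Y) :
  fmap (shiftz a) f = fmap (shiftz a) f' -> f = f'.
Proof. exact: (quasi_inverse_faithful (shiftzNK a)). Qed.

Lemma shiftz_full (a : int) X Y (c : hom (shiftz a X) (shiftz a Y)) :
  exists f : hom X Y, fmap (shiftz a) f = c.
Proof. exact: (quasi_inverse_full (shiftzNK a) (shiftzKN a)). Qed.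

Lemma shiftz_compE (a b : int) X :
  isomorphic (shiftz a (shiftz b X)) (shiftz (a + b) X).
Proof. by exists (shiftz_comp a b X); exact: (ni_iso (shiftz_comp a b)). Qed.

End Powers.

Lemma binat_iso_sym (C D E : precategory) (F G : bifunctor C D E) :
  binat_iso F G -> binat_iso G F.
Proof.
move=> a; pose b X Y := projT1 (cid (bni_iso a X Y)).
have [ba ab] : (forall X Y, b X Y \oc a X Y = idm _) /\
    (forall X Y, a X Y \oc b X Y = idm _).
  by split=> X Y; rewrite /b; case: cid => ? [].
refine (@BinatIso _ _ _ G F b _ _) => [X Y|X X' Y Y' f g].
  by exists (a X Y).
apply: (iso_epi (f := a X Y)); first exact: bni_iso.
by rewrite -!compA bni_nat ba compm1 compA ba comp1m.
Qed.

(** Exchanging the variables lets the second one be treated as the first. *)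
Definition flipB (C D E : precategory) (B : bifunctor C D E) :
  bifunctor D C E.
Proof.
apply: (@Bifunctor D C E (fun Y X => B X Y) (fun Y Y' X X' g f => bmap B f g)).
- by move=> Y X; exact: bmap1.
- by move=> *; exact: bmapM.
Defined.

Section BifunctorShift.
Variables C D E : triangulated_category.
Variable B : bifunctor C D E.

(** This carries commutation with [shift] over to [unshift]: the map is
    [F' X (x) M -> G' G (F' X (x) M) -> G' (F F' X (x) M) -> G' (X (x) M)]. *)
Lemma bif_quasi_inverse (F F' : functor C C) (G G' : functor E E) :
  nat_iso (compF F F') (idF C) -> nat_iso (compF G' G) (idF E) ->
  binat_iso (preB B F (idF D)) (postB G B) ->
  binat_iso (preB B F' (idF D)) (postB G' B).
Proof.
move=> a /nat_iso_sym b /binat_iso_sym s.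
refine (@BinatIso _ _ _ (preB B F' (idF D)) (postB G' B)
  (fun X M => fmap G' (bmap B (a X) (idm M)) \oc
  (fmap G' (s (F' X) M) \oc b (B (F' X) M))) _ _) => [X M|X X' M M' f g] /=.
  apply: is_iso_compose; first apply/fmap_iso/bmap_iso/is_iso_idm.
    exact: (ni_iso a).
  by apply: is_iso_compose; [exact/fmap_iso/(bni_iso s) | exact: (ni_iso b)].
apply: (square_comp (g := fmap G' (bmap B (fmap F (fmap F' f)) g))).
  apply: (square_comp (ni_nat b _)).
  by rewrite /= -!fmapM; congr (fmap G' _); exact: (bni_nat s).
by rewrite -!fmapM -!bmapM compm1 comp1m (ni_nat a).
Qed.

Lemma bif_comp (F F' F'' : functor C C) (G G' G'' : functor E E) :
  nat_iso F'' (compF F F') -> nat_iso G'' (compF G G') ->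
  binat_iso (preB B F (idF D)) (postB G B) ->
  binat_iso (preB B F' (idF D)) (postB G' B) ->
  binat_iso (preB B F'' (idF D)) (postB G'' B).
Proof.
move=> a /nat_iso_sym b s s'.
refine (@BinatIso _ _ _ (preB B F'' (idF D)) (postB G'' B)
  (fun X M => b (B X M) \oc (fmap G (s' X M) \oc
  (s (F' X) M \oc bmap B (a X) (idm M)))) _ _) => [X M|X X' M M' f g] /=.
  apply: is_iso_compose; first exact: (ni_iso b).
  apply: is_iso_compose; first exact/fmap_iso/(bni_iso s').
  apply: is_iso_compose; first exact: (bni_iso s).
  by apply: bmap_iso (is_iso_idm _); exact: (ni_iso a).
apply: square_comp (ni_nat b _); apply: (square_comp (g := fmap G _)).
  apply: square_comp (bni_nat s _ _).
  by rewrite /= -!bmapM compm1 comp1m; congr (bmap B _ g); exact: (ni_nat a).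
by rewrite /= -!fmapM; congr (fmap G _); exact: (bni_nat s' f g).
Qed.

Lemma bif_shiftz (s : binat_iso (preB B shift (idF D)) (postB shift B))
  (a : int) : binat_iso (preB B (shiftz a) (idF D)) (postB (shiftz a) B).
Proof.
elim/int_updown: a => [|a IH|a IH].
- refine (@BinatIso _ _ _ (preB B (shiftz 0) (idF D)) (postB (shiftz 0) B)
    (fun X M => idm (B X M)) _ _) => [X M|X X' M M' f g].
    exact: is_iso_idm.
  by rewrite /= compm1 comp1m.
- exact: bif_comp (shiftz_succ C a) (shiftz_succ E a) s IH.
- apply: bif_comp (shiftz_pred C a) (shiftz_pred E a) _ IH.
  exact: bif_quasi_inverse (unshiftK C) (shiftK E) s.
Qed.

End BifunctorShift.

Section ExactBifunctor.
Variables C D E : triangulated_category.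
Variable B : exact_bifunctor C D E.

Lemma act_shiftz_l (a : int) :
  binat_iso (preB B (shiftz a) (idF D)) (postB (shiftz a) B).
Proof. exact: bif_shiftz (eb_shl B) a. Qed.

Lemma act_shiftz_r (a : int) :
  binat_iso (preB B (idF C) (shiftz a)) (postB (shiftz a) B).
Proof.
have s0 : binat_iso (preB (flipB B) shift (idF C)) (postB shift (flipB B)).
  refine (@BinatIso _ _ _ (preB (flipB B) shift (idF C))
    (postB shift (flipB B)) (fun M X => eb_shr B X M) _ _)
    => [M X|M M' X X' g f].
    exact: (bni_iso (eb_shr B)).
  exact (bni_nat (eb_shr B) f g).
have s := bif_shiftz s0 a.
refine (@BinatIso _ _ _ (preB B (idF C) (shiftz a)) (postB (shiftz a) B)
  (fun X M => s M X) _ _) => [X M|X X' M M' f g].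
  exact: (bni_iso s).
exact (bni_nat s g f).
Qed.

(** The shifts can be moved out of the two variables in either order, with
    results that may differ by a sign.  The Kunneth maps may be built with any
    choice, as naturality is all that enters their construction. *)
Lemma act_shiftz (a b : int) :
  binat_iso (preB B (shiftz a) (shiftz b)) (postB (shiftz (a + b)) B).
Proof.
have [[l r] c] := (act_shiftz_l a, act_shiftz_r b, shiftz_comp E a b).
refine (@BinatIso _ _ _ (preB B (shiftz a) (shiftz b))
  (postB (shiftz (a + b)) B)
  (fun X M => c (B X M) \oc
  (fmap (shiftz a) (r X M) \oc l X (shiftz b M))) _ _)
  => [X M|X X' M M' f g] /=.
  apply: is_iso_compose; first exact: (ni_iso c).
  by apply: is_iso_compose; [exact/fmap_iso/(bni_iso r) | exact: (bni_iso l)].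
apply: square_comp (ni_nat c _).
apply: (square_comp (bni_nat l _ _)).
by rewrite /= -!fmapM; congr (fmap _ _); exact: (bni_nat r f g).
Qed.

End ExactBifunctor.

(** * Distinguished triangles *)

Section Triangles.
Variable C : triangulated_category.
Implicit Types X Y Z W : C.

Lemma compBl X Y Z (g g' : hom Y Z) (f : hom X Y) :
  (g - g') \oc f = g \oc f - g' \oc f.
Proof. by rewrite compDl compNm. Qed.

Lemma compBr X Y Z (g : hom Y Z) (f f' : hom X Y) :
  g \oc (f - f') = g \oc f - g \oc f'.
Proof. by rewrite compDr compmN. Qed.

Lemma comp_suml (I : Type) (s : seq I) X Y Z (F : I -> hom Y Z) (f : hom X Y) :
  (\sum_(i <- s) F i) \oc f = \sum_(i <- s) F i \oc f.
Proof.
elim: s => [|i s IH]; first by rewrite !big_nil comp0m.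
by rewrite !big_cons compDl IH.
Qed.

Lemma comp_sumr (I : Type) (s : seq I) X Y Z (g : hom Y Z) (F : I -> hom X Y) :
  g \oc (\sum_(i <- s) F i) = \sum_(i <- s) g \oc F i.
Proof.
elim: s => [|i s IH]; first by rewrite !big_nil compm0.
by rewrite !big_cons compDr IH.
Qed.

Lemma idm0_is_zero Z : idm Z = 0 -> is_zero Z.
Proof.
by move=> Z0 X; split=> f; [rewrite -[f]comp1m | rewrite -[f]compm1];
  rewrite Z0 ?comp0m ?compm0.
Qed.

Lemma is_iso_opp X Y (f : hom X Y) : is_iso f -> is_iso (- f).
Proof.
by case=> g [gK fK]; exists (- g); rewrite !compNm !compmN !opprK gK fK.
Qed.

Lemma dist_comp0 X Y Z (f : hom X Y) (g : hom Y Z) h :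
  dist f g h -> g \oc f = 0.
Proof.
move=> dfg; have [O zO] := has_zero C.
have [|c [cE _]] := dist_morph (a := idm X) (b := f) (dist_id X zO) dfg => //.
by rewrite -cE compm0.
Qed.

Lemma dist_comp0' X Y Z (f : hom X Y) (g : hom Y Z) h :
  dist f g h -> h \oc g = 0.
Proof. by move/dist_rot/dist_comp0. Qed.

(** Three rotations give this with all three maps negated; changing the sign
    of the middle object removes two of the signs. *)
Lemma dist_shift X Y Z (f : hom X Y) (g : hom Y Z) h :
  dist f g h -> dist (fmap shift f) (fmap shift g) (- fmap shift h).
Proof.
move=> /dist_rot/dist_rot/dist_rot.
apply: (dist_iso (a := idm _) (b := - idm _) (c := idm _));
  rewrite ?fmap1 ?compNm ?compmN ?comp1m ?compm1 ?opprK //.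
- exact: is_iso_idm.
- exact/is_iso_opp/is_iso_idm.
- exact: is_iso_idm.
Qed.

(** The fiber is the desuspension of the cone. *)
Lemma exists_fiber Y Z (g : hom Y Z) :
  exists X (f : hom X Y) h, dist f g h.
Proof.
have [W [g1 [h1 dg]]] := dist_cone g.
have [e [eK Ke]] : is_iso (unshiftK C W : hom (shift (unshift W)) W).
  exact: (ni_iso (unshiftK C)).
have [f fE] := shift_full (- (h1 \oc unshiftK C W)).
exists (unshift W), f, (e \oc g1); apply/dist_rot; rewrite fE opprK.
apply: dist_iso dg; try exact: is_iso_idm.
- by exists (unshiftK C W); split; [exact: Ke | exact: eK].
- by rewrite comp1m compm1.
- by rewrite compm1.
- by rewrite fmap1 comp1m -compA Ke compm1.
Qed.

(** The difference [e] of [c] and the identity kills [g], so it factors through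
    [h], and it is killed by [h]; hence [e] squares to zero and [1 + e] is
    invertible. *)
Lemma cone_endo_iso X Y Z (f : hom X Y) (g : hom Y Z) h (c : hom Z Z) :
  dist f g h -> c \oc g = g -> h \oc c = h -> is_iso c.
Proof.
move=> dfg cg hc; pose e := c - idm Z.
have eg : e \oc g = 0 by rewrite compBl cg comp1m subrr.
have /dist_rot dgh := dfg.
have [v vE] := dist_weak_coker dgh eg.
have ee : e \oc e = 0.
  by rewrite -{1}vE -compA compBr hc compm1 subrr compm0.
have cE : c = idm Z + e by rewrite addrC subrK.
exists (idm Z - e); rewrite {}cE.
move: (e) ee => {c hc cg e eg vE dgh} e ee; split.
  by rewrite compBl !compDr !comp1m !compm1 ee addr0 addrK.
by rewrite compBr !compDl !comp1m !compm1 ee addr0 addrK.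
Qed.

Lemma cone_unique X Y Z Z' (f : hom X Y) (g : hom Y Z) h (g' : hom Y Z') h' :
  dist f g h -> dist f g' h' ->
  exists c : hom Z Z', [/\ is_iso c, c \oc g = g' & h' \oc c = h].
Proof.
move=> d d'.
have [|c [cg]] := dist_morph (a := idm X) (b := idm Y) d d'.
  by rewrite comp1m compm1.
have [|c' [cg']] := dist_morph (a := idm X) (b := idm Y) d' d.
  by rewrite comp1m compm1.
rewrite fmap1 !compm1 !comp1m in cg cg' * => hc' hc.
exists c; split=> //.
have [k [kK _]] : is_iso (c' \oc c).
  by apply: cone_endo_iso d _ _; rewrite -?compA ?cg // compA -hc'.
have [k' [_ k'K]] : is_iso (c \oc c').
  by apply: cone_endo_iso d' _ _; rewrite -?compA ?cg' // compA -hc.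
exists (k \oc c'); split; first by rewrite -compA.
rewrite -k'K -[in RHS]compA; congr (c \oc _).
rewrite -[RHS]comp1m -kK -!compA; congr (k \oc _).
by rewrite !compA -(compA _ c) -(compA c') k'K compm1.
Qed.

(** A vanishing cone makes [f] a weak kernel and a weak cokernel of zero maps,
    which gives one-sided inverses on both sides. *)
Lemma dist_zero_iso X Y Z (f : hom X Y) (g : hom Y Z) h :
  dist f g h -> is_zero Z -> is_iso f.
Proof.
move=> d zZ.
have [|s sE] := dist_weak_ker (w := idm Y) d; first exact: (proj1 (zZ Y)).
have /dist_rot/dist_rot d' := d.
have [|v vE] := dist_weak_coker (w := idm (shift X)) d'.
  exact: (proj2 (zZ _)).
have [r rE] := shift_full (- v).
have rf : r \oc f = idm X.
  by apply: shift_inj; rewrite fmapM rE fmap1 compNm -compmN.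
exists r; split=> //; rewrite -sE; congr (f \oc _).
by rewrite -[LHS]compm1 -sE compA rf comp1m.
Qed.

End Triangles.

(** * Calculus of t-structures *)

Section TStructure.
Variable C : triangulated_category.
Implicit Types X Y Z W : C.

Lemma shiftz_iso (n : int) X Y : isomorphic X Y ->
  isomorphic (shiftz n X) (shiftz n Y).
Proof. by case=> f fi; exists (fmap (shiftz n) f); exact: fmap_iso. Qed.

Lemma shiftedE (P : C -> Prop) (n : int) X : iso_closed P ->
  shifted P n X <-> P (shiftz (- n) X).
Proof.
move=> isoP; split=> [[Y PY XY]|PX].
  apply: isoP PY; apply: isomorphic_sym.
  apply: isomorphic_trans (shiftz_iso _ XY) _.
  by have := shiftz_compE (- n) n Y; rewrite addNr.
exists (shiftz (- n) X) => //; apply: isomorphic_sym.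
by have := shiftz_compE n (- n) X; rewrite addrN.
Qed.

Lemma shiftz_shiftz_iso_closed (P : C -> Prop) (n k : int) X : iso_closed P ->
  P (shiftz n (shiftz k X)) <-> P (shiftz (n + k) X).
Proof.
by move=> isoP; split; apply: isoP;
  [|apply: isomorphic_sym]; exact: shiftz_compE.
Qed.

Variable t : tstructure C.

Lemma leNE (n : int) X : leN t n X <-> le0 t (shiftz n X).
Proof. by rewrite /leN shiftedE ?opprK //; exact: le0_iso. Qed.

Lemma geNE (n : int) X : geN t n X <-> ge0 t (shiftz n X).
Proof. by rewrite /geN shiftedE ?opprK //; exact: ge0_iso. Qed.

Lemma leN0 X : leN t 0 X <-> le0 t X. Proof. exact (leNE 0 X). Qed.

Lemma geN0 X : geN t 0 X <-> ge0 t X. Proof. exact (geNE 0 X). Qed.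

Lemma leN_iso (n : int) : iso_closed (leN t n).
Proof. by move=> X Y XY; rewrite !leNE; apply/le0_iso/shiftz_iso. Qed.

Lemma geN_iso (n : int) : iso_closed (geN t n).
Proof. by move=> X Y XY; rewrite !geNE; apply/ge0_iso/shiftz_iso. Qed.

Lemma leN_shiftz (n k : int) X : leN t n (shiftz k X) <-> leN t (n + k) X.
Proof. by rewrite !leNE shiftz_shiftz_iso_closed //; exact: le0_iso. Qed.

Lemma geN_shiftz (n k : int) X : geN t n (shiftz k X) <-> geN t (n + k) X.
Proof. by rewrite !geNE shiftz_shiftz_iso_closed //; exact: ge0_iso. Qed.

Lemma leN_shift (n : int) X : leN t n (shift X) <-> leN t (n + 1) X.
Proof. exact (leN_shiftz n 1 X). Qed.

Lemma geN_shift (n : int) X : geN t n (shift X) <-> geN t (n + 1) X.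
Proof. exact (geN_shiftz n 1 X). Qed.

Lemma leN_mono (m n : int) X : m <= n -> leN t m X -> leN t n X.
Proof.
move=> mn; have [k ->] : exists k : nat, n = m + k%:Z by exists `|n - m|%N; lia.
elim: k {n mn} => [|k IH] leX; first by rewrite addr0.
have /leNE/le0_le1 := IH leX; rewrite shiftedE ?opprK; last exact: le0_iso.
rewrite shiftz_shiftz_iso_closed; last exact: le0_iso.
by rewrite -leNE addrCA -intS.
Qed.

Lemma geN_mono (m n : int) X : m <= n -> geN t n X -> geN t m X.
Proof.
move=> mn; have [k ->] : exists k : nat, n = m + k%:Z by exists `|n - m|%N; lia.
elim: k {n mn} => [|k IH] geX; first by rewrite addr0 in geX.
apply/IH/geNE/ge1_ge0; rewrite shiftedE ?opprK; last exact: ge0_iso.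
rewrite shiftz_shiftz_iso_closed; last exact: ge0_iso.
by rewrite -geNE addrCA -intS.
Qed.

Lemma leN_geN_hom (m n : int) X Y (f : hom X Y) :
  leN t m X -> geN t n Y -> m < n -> f = 0.
Proof.
move=> /leNE leX geY mn.
have hom0 (g : hom (shiftz m X) (shiftz m Y)) : g = 0.
  apply: (le0_ge1_hom (t := t)) => //; rewrite shiftedE; last exact: ge0_iso.
  rewrite opprK shiftz_shiftz_iso_closed; last exact: ge0_iso.
  by rewrite -geNE; apply: geN_mono geY; lia.
by apply: (@shiftz_inj _ m); rewrite (hom0 (fmap _ f)) (hom0 (fmap _ 0)).
Qed.

(** The truncation triangle at level [n] is obtained from the one at level
    [0] by moving one step up or down; going up requires undoing a shift, for
    which uniqueness of cones is used. *)
Lemma trunc_dist (n : int) X : exists A B (i : hom A X) (p : hom X B) d,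
  [/\ leN t n A, geN t (n + 1) B & dist i p d].
Proof.
elim/int_updown: n X => [|n IH|n IH] X.
- have [A [B [i [p [d [leA geB dX]]]]]] := le0_ge1_dist t X.
  by exists A, B, i, p, d; split=> //; exact/leN0.
- have [A [B [i [p [d [leA geB dX]]]]]] := IH (shift X).
  have [e [eK Ke]] : is_iso (unshiftK C A : hom (shift (unshift A)) A).
    exact: (ni_iso (unshiftK C)).
  have [i' i'E] := shift_full (i \oc unshiftK C A).
  have [B' [p' [d' dX']]] := dist_cone i'.
  exists (unshift A), B', i', p', d'; split=> //.
    by rewrite -leN_shift; apply: leN_iso leA; exists e, (unshiftK C A).
  have d1 : dist i (fmap shift p')
      (- (fmap shift (unshiftK C A)) \oc fmap shift d').
    apply: dist_iso (dist_shift dX').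
    + by exists e; split; [exact: eK | exact: Ke].
    + exact: is_iso_idm.
    + exact: is_iso_idm.
    + by rewrite comp1m i'E.
    + by rewrite comp1m compm1.
    + by rewrite compm1 compmN compNm.
  have [c [ci _ _]] := cone_unique dX d1.
  by rewrite -geN_shift; apply: geN_iso geB; exists c.
- have [A [B [i [p [d [leA geB dX]]]]]] := IH (unshift X).
  have [e [eK Ke]] : is_iso (unshiftK C X : hom (shift (unshift X)) X).
    exact: (ni_iso (unshiftK C)).
  exists (shift A), (shift B), (unshiftK C X \oc fmap shift i).
  exists (fmap shift p \oc e), (- fmap shift d).
  split; first by rewrite leN_shift subrK.
    by rewrite geN_shift subrK.
  apply: dist_iso (dist_shift dX).
  + exact: is_iso_idm.
  + by exists e; split; [exact: eK | exact: Ke].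
  + exact: is_iso_idm.
  + by rewrite compm1.
  + by rewrite comp1m -compA eK compm1.
  + by rewrite fmap1 comp1m compm1.
Qed.

(** In the truncation triangle [A -> X -> B] at level [n] the second map
    vanishes, so the identity of [B] factors through the shift of [A], from
    which there are no nonzero maps to [B]. *)
Lemma leN_orth (n : int) X :
  (forall Y (f : hom X Y), geN t (n + 1) Y -> f = 0) -> leN t n X.
Proof.
move=> orth; have [A [B [i [p [d [leA geB dX]]]]]] := trunc_dist n X.
have p0 := orth _ p geB.
have /dist_rot dpd := dX.
have [|v vE] := dist_weak_coker (w := idm B) dpd; first by rewrite p0 compm0.
have zB : is_zero B.
  apply: idm0_is_zero; rewrite -vE (_ : v = 0) ?comp0m //.
  apply: (leN_geN_hom (m := n - 1)) geB _; last by lia.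
  by rewrite leN_shift subrK.
by apply: leN_iso leA; exists i; exact: dist_zero_iso dX zB.
Qed.

Lemma geN_orth (n : int) X :
  (forall Y (f : hom Y X), leN t (n - 1) Y -> f = 0) -> geN t n X.
Proof.
move=> orth; have [A [B [i [p [d [leA geB dX]]]]]] := trunc_dist (n - 1) X.
have i0 := orth _ i leA; rewrite subrK in geB.
have /dist_rot/dist_rot d' := dX.
have [|v vE] := dist_weak_ker (w := idm (shift A)) d'.
  by rewrite i0 fmap_shift0 oppr0 comp0m.
have zA : is_zero (shift A).
  apply: idm0_is_zero; rewrite -vE (_ : v = 0) ?compm0 //.
  apply: (leN_geN_hom (m := n - 2)) geB _; last by lia.
  by rewrite leN_shift; apply: leN_mono leA; lia.
have [|k [kK pk]] := dist_zero_iso (_ : dist p d (- fmap shift i)) zA.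
  exact/dist_rot.
by apply: geN_iso geB; exists k, p.
Qed.

Lemma leN_ext (n : int) X Y Z (f : hom X Y) (g : hom Y Z) h :
  dist f g h -> leN t n X -> leN t n Z -> leN t n Y.
Proof.
move=> d leX leZ; apply: leN_orth => W w geW.
have [|v <-] := dist_weak_coker (w := w) d.
  by apply: leN_geN_hom leX geW _; lia.
by rewrite (_ : v = 0) ?comp0m //; apply: leN_geN_hom leZ geW _; lia.
Qed.

Lemma geN_ext (n : int) X Y Z (f : hom X Y) (g : hom Y Z) h :
  dist f g h -> geN t n X -> geN t n Z -> geN t n Y.
Proof.
move=> d geX geZ; apply: geN_orth => W w leW.
have [|v <-] := dist_weak_ker (w := w) d.
  by apply: leN_geN_hom leW geZ _; lia.
by rewrite (_ : v = 0) ?compm0 //; apply: leN_geN_hom leW geX _; lia.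
Qed.

Lemma leN_zero (n : int) X : is_zero X -> leN t n X.
Proof. by move=> zX; apply: leN_orth => Y f _; exact: (proj2 (zX Y)). Qed.

Lemma leN_geN_zero (m n : int) X : leN t m X -> geN t n X -> m < n -> is_zero X.
Proof.
by move=> leX geX mn; apply: idm0_is_zero; exact: leN_geN_hom leX geX mn.
Qed.

Lemma leN_cone (n : int) X Y Z (f : hom X Y) (g : hom Y Z) h :
  dist f g h -> leN t (n + 1) X -> leN t n Y -> leN t n Z.
Proof.
by move=> /dist_rot d leX leY; apply: leN_ext d leY _; rewrite leN_shift.
Qed.

Lemma leN_fiber (n : int) X Y Z (f : hom X Y) (g : hom Y Z) h :
  dist f g h -> leN t n Y -> leN t (n - 1) Z -> leN t n X.
Proof.
move=> /dist_rot/dist_rot d leY leZ.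
rewrite -[n](subrK 1) -leN_shift; apply: leN_ext d leZ _.
by rewrite leN_shift subrK.
Qed.

Lemma geN_fiber (n : int) X Y Z (f : hom X Y) (g : hom Y Z) h :
  dist f g h -> geN t n Y -> geN t (n - 1) Z -> geN t n X.
Proof.
move=> /dist_rot/dist_rot d geY geZ.
rewrite -[n](subrK 1) -geN_shift; apply: geN_ext d geZ _.
by rewrite geN_shift subrK.
Qed.

End TStructure.

(** * Truncations *)

Section Truncations.
Variables (C : triangulated_category) (t : tstructure C).
Implicit Types X Y Z W U V : C.

(** The universal property alone, with no triangle: it is transported by any
    equivalence, whereas the third map of a shifted triangle changes sign. *)
Definition is_trunc (n : int) A X (f : hom A X) : Prop :=
  leN t n A /\
  forall U (u : hom U X), leN t n U -> exists! v : hom U A, f \oc v = u.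

Lemma trunc_inj (n : int) A X (f : hom A X) U (v v' : hom U A) :
  is_trunc n f -> leN t n U -> f \oc v = f \oc v' -> v = v'.
Proof.
move=> [_ univ] leU E; have [w [_ wu]] := univ U (f \oc v) leU.
by rewrite -(wu v) // -(wu v').
Qed.

Lemma trunc_lift (n : int) A X (f : hom A X) U (u : hom U X) :
  is_trunc n f -> leN t n U -> exists v : hom U A, f \oc v = u.
Proof. by move=> [_ univ] leU; have [w [wE _]] := univ U u leU; exists w. Qed.

(** Two lifts differ by a map that comes from the desuspension of [B], hence by
    zero. *)
Lemma trunc_of_dist (n : int) A X B (i : hom A X) (p : hom X B) d :
  dist i p d -> leN t n A -> geN t (n + 1) B -> is_trunc n i.
Proof.
move=> dX leA geB; split=> // U u leU.
have [|v vE] := dist_weak_ker (w := u) dX.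
  by apply: leN_geN_hom leU geB _; lia.
exists v; split=> // v' v'E; apply/eqP; rewrite -subr_eq0; apply/eqP.
have /dist_rot/dist_rot dX' := dX.
have [|k kE] := dist_weak_ker (w := fmap shift (v - v')) dX'.
  by rewrite compNm -fmapM compBr vE v'E subrr fmap_shift0 oppr0.
apply: shift_inj; rewrite fmap_shift0 -kE.
rewrite (_ : k = 0) ?compm0 //; apply: (leN_geN_hom (m := n)) geB _.
  by rewrite leN_shift; apply: leN_mono leU; lia.
lia.
Qed.

Lemma trunc_le_iso (n : int) A X (f : hom A X) :
  is_trunc n f -> leN t n X -> is_iso f.
Proof.
move=> tf leX; have [v vE] := trunc_lift (idm X) tf leX; exists v; split=> //.
by apply: (trunc_inj tf (proj1 tf)); rewrite compA vE comp1m compm1.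
Qed.

Lemma trunc_ge_zero (n : int) A X (f : hom A X) :
  is_trunc n f -> geN t (n + 1) X -> is_zero A.
Proof.
move=> tf geX; apply/idm0_is_zero/(trunc_inj tf (proj1 tf)).
by rewrite compm0 compm1; apply: leN_geN_hom (proj1 tf) geX _; lia.
Qed.

Lemma trunc_cone (n : int) A X B (f : hom A X) (g : hom X B) h :
  is_trunc n f -> dist f g h -> geN t (n + 1) B.
Proof.
move=> tf d; have [A0 [B0 [i [p [d0 [leA geB dX]]]]]] := trunc_dist t n X.
have ti := trunc_of_dist dX leA geB.
have [[a aE] [b bE]] := (trunc_lift i tf leA, trunc_lift f ti (proj1 tf)).
have ai : is_iso a.
  exists b; split.
    by apply: (trunc_inj ti leA); rewrite compA bE aE compm1.
  by apply: (trunc_inj tf (proj1 tf)); rewrite compA aE bE compm1.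
have d1 : dist f p (fmap shift a \oc d0).
  apply: dist_iso dX => //; try exact: is_iso_idm.
  - exact: ai.
  - by rewrite comp1m aE.
  - by rewrite comp1m compm1.
  - by rewrite compm1.
have [c [ci _ _]] := cone_unique d1 d.
by apply: geN_iso geB; exists c.
Qed.

(** Shifting is an equivalence, so truncations of [shiftz k X] come from
    truncations of [X]. *)
Lemma trunc_unshift (m k : int) A X (f : hom A (shiftz k X)) : is_trunc m f ->
  exists A' (f' : hom A' X) (a : hom (shiftz k A') A),
  [/\ is_iso a, is_trunc (m + k) f' & f \oc a = fmap (shiftz k) f'].
Proof.
move=> tf; set A' := shiftz (- k) A.
have [a ai] : isomorphic (shiftz k A') A.
  by have := shiftz_compE k (- k) A; rewrite addrN.
have [f' f'E] := shiftz_full (f \oc a).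
exists A', f', a; split=> //; split.
  rewrite -leN_shiftz; apply: leN_iso (proj1 tf).
  by apply: isomorphic_sym; exists a.
move=> U u; rewrite -leN_shiftz => leU.
have [v vE] := trunc_lift (fmap (shiftz k) u) tf leU.
have [b [ba ab]] := ai.
have [w wE] := shiftz_full (b \oc v).
exists w; split.
  apply: (@shiftz_inj _ k).
  by rewrite fmapM f'E wE -compA (compA a) ab comp1m.
move=> w' w'E; apply: (@shiftz_inj _ k); rewrite wE.
rewrite -[RHS]comp1m -ba -compA; congr (b \oc _).
by apply: (trunc_inj tf leU); rewrite compA -f'E -fmapM w'E.
Qed.

(** * Generalized elements of cohomology objects *)

(** Epimorphisms on [H^m], tested on maps to [geN t m]: a map from [U] in
    [leN t m] to such an object depends only on [H^m U]. *)
Definition cover (m : int) V U (e : hom V U) : Prop :=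
  [/\ leN t m V, leN t m U &
    forall W (w : hom U W), geN t m W -> w \oc e = 0 -> w = 0].

(** The element of [H^m Y] represented by [y] is zero. *)
Definition null (m : int) U Y (y : hom U Y) : Prop :=
  forall W (w : hom Y W), geN t m W -> w \oc y = 0.

(** With [loc_inj], surjectivity and injectivity of [f] on [H^m], read on
    generalized elements. *)
Definition loc_surj (m : int) A B (f : hom A B) : Prop :=
  forall U (b : hom U B), leN t m U ->
  exists V (e : hom V U) (a : hom V A), cover m e /\ f \oc a = b \oc e.

Definition loc_inj (m : int) A B (f : hom A B) : Prop :=
  forall U (a : hom U A), leN t m U -> f \oc a = 0 -> null m a.

Lemma cover_id (m : int) U : leN t m U -> cover m (idm U).
Proof. by move=> leU; split=> // W w _; rewrite compm1. Qed.

Lemma cover_comp (m : int) U V W (e : hom V U) (e' : hom W V) :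
  cover m e -> cover m e' -> cover m (e \oc e').
Proof.
move=> [_ leU eU] [leW _ eV]; split=> // Z w geZ.
by rewrite compA => /(eV _ _ geZ)/(eU _ _ geZ).
Qed.

(** The fiber of [w] is a cover, as [w] is zero on [H^m]. *)
Lemma cover_kill (m : int) U W (w : hom U W) : leN t m U -> leN t (m - 1) W ->
  exists V (e : hom V U), cover m e /\ w \oc e = 0.
Proof.
move=> leU leW; have [V [e [h d]]] := exists_fiber w.
exists V, e; split; last exact: dist_comp0 d.
split=> //; first exact: leN_fiber d leU leW.
move=> Z z geZ /(dist_weak_coker d)[v <-].
by rewrite (_ : v = 0) ?comp0m //; apply: leN_geN_hom leW geZ _; lia.
Qed.

(** A null element factors through the truncation below [m], and a suitable
    cover kills the map to that truncation. *)
Lemma null_cover (m : int) U Y (y : hom U Y) : leN t m U -> null m y ->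
  exists V (e : hom V U), cover m e /\ y \oc e = 0.
Proof.
move=> leU y0; have [A [B [i [p [d [leA geB dY]]]]]] := trunc_dist t (m - 1) Y.
rewrite subrK in geB.
have [z zE] := dist_weak_ker dY (y0 _ p geB).
have [V [e [ce ze]]] := cover_kill z leU leA.
by exists V, e; rewrite -zE -compA ze compm0.
Qed.

Lemma cover_null (m : int) U V Y (e : hom V U) (y : hom U Y) :
  cover m e -> null m (y \oc e) -> null m y.
Proof.
by move=> [_ _ eU] ye W w geW; apply: eU => //; rewrite -compA; exact: ye.
Qed.

Lemma null0 (m : int) U Y : null m (0 : hom U Y).
Proof. by move=> W w _; rewrite compm0. Qed.

Lemma null_post (m : int) U Y Z (y : hom U Y) (f : hom Y Z) :
  null m y -> null m (f \oc y).
Proof. by move=> y0 W w geW; rewrite compA; exact: y0. Qed.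

Lemma null_pre (m : int) U V Y (y : hom U Y) (e : hom V U) :
  null m y -> null m (y \oc e).
Proof. by move=> y0 W w geW; rewrite compA y0 // comp0m. Qed.

Lemma null_ge (m : int) U Y (y : hom U Y) : geN t m Y -> null m y -> y = 0.
Proof. by move=> geY y0; rewrite -(comp1m y); exact: y0. Qed.

Lemma loc_injP (m : int) A B (f : hom A B) U (a : hom U A) :
  loc_inj m f -> leN t m U -> null m (f \oc a) -> null m a.
Proof.
move=> fi leU fa; have [V [e [ce fae]]] := null_cover leU fa.
apply: cover_null (ce) _; apply: fi; first by case: ce.
by rewrite compA.
Qed.

Definition loc_bij (m : int) A B (f : hom A B) : Prop :=
  loc_surj m f /\ loc_inj m f.

Lemma loc_bij_comp (m : int) X Y Z (f : hom X Y) (g : hom Y Z) :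
  loc_bij m f -> loc_bij m g -> loc_bij m (g \oc f).
Proof.
move=> [fs fi] [gs gi]; split=> [U z leU|U x leU].
  have [V [e [y [ce yE]]]] := gs U z leU.
  have [leV _ _] := ce.
  have [V' [e' [x [ce' xE]]]] := fs V y leV.
  exists V', (e \oc e'), x; split; first exact: cover_comp.
  by rewrite -compA xE compA yE compA.
rewrite -compA => /(gi _ _ leU) fx.
exact: loc_injP fi leU fx.
Qed.

Lemma loc_surj_comp_last (m : int) X Y Z (f : hom X Y) (g : hom Y Z) :
  loc_surj m (g \oc f) -> loc_surj m g.
Proof.
move=> gfs U z leU; have [V [e [x [ce xE]]]] := gfs U z leU.
by exists V, e, (f \oc x); rewrite compA.
Qed.

Lemma loc_bij_cancel_l (m : int) X Y Z (f : hom X Y) (g : hom Y Z) :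
  loc_bij m g -> loc_bij m (g \oc f) -> loc_bij m f.
Proof.
move=> [_ gi] [gfs gfi]; split=> [U y leU|U x leU fx].
  have [V [e [x [ce xE]]]] := gfs U (g \oc y) leU.
  have [leV _ _] := ce.
  have [|V' [e' [ce' /eqP]]] := null_cover leV (y := f \oc x - y \oc e).
    by apply: gi; rewrite // compBr !compA xE subrr.
  rewrite compBl subr_eq0 -!compA => /eqP xE'.
  by exists V', (e \oc e'), (x \oc e'); split; first exact: cover_comp.
by apply: gfi; rewrite // -compA fx compm0.
Qed.

Lemma loc_bij_cancel_r (m : int) X Y Z (f : hom X Y) (g : hom Y Z) :
  loc_bij m f -> loc_bij m (g \oc f) -> loc_bij m g.
Proof.
move=> [fs _] [gfs gfi]; split=> [|U y leU gy].
  exact: loc_surj_comp_last gfs.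
have [V [e [x [ce xE]]]] := fs U y leU.
have [leV _ _] := ce.
apply: cover_null (ce) _; rewrite -xE; apply: null_post.
by apply: gfi; rewrite // -compA xE compA gy comp0m.
Qed.

Lemma loc_bij_iso (m : int) X Y (f : hom X Y) : is_iso f -> loc_bij m f.
Proof.
move=> fi; have [g [gK fK]] := fi; split=> [U y leU|U x leU fx0].
  exists U, (idm U), (g \oc y); split; first exact: cover_id.
  by rewrite compA fK comp1m compm1.
by rewrite (_ : x = 0); [exact: null0 | apply: (iso_mono fi); rewrite compm0].
Qed.

Lemma loc_bij_fiber (m : int) X Y Z (k : hom X Y) (f : hom Y Z) h :
  dist k f h -> leN t (m - 1) X -> loc_bij m f.
Proof.
move=> d leX; split=> [U z leU|U y leU].
  have [|V [e [ce he]]] := cover_kill (h \oc z) leU.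
    by rewrite leN_shift; apply: leN_mono leX; lia.
  have [|y yE] := dist_weak_ker (w := z \oc e) (proj1 (dist_rot _ _ _) d).
    by rewrite compA.
  by exists V, e, y.
move=> /(dist_weak_ker d)[x <-] W w geW; rewrite compA.
by rewrite (_ : w \oc k = 0) ?comp0m //; apply: leN_geN_hom leX geW _; lia.
Qed.

Lemma loc_bij_cone (m : int) X Y Z (f : hom X Y) (g : hom Y Z) h :
  dist f g h -> geN t (m + 1) Z -> loc_bij m f.
Proof.
move=> d geZ; split=> [U y leU|U x leU fx].
  have [|x xE] := dist_weak_ker (w := y) d.
    by apply: leN_geN_hom leU geZ _; lia.
  by exists U, (idm U), x; rewrite compm1; split; first exact: cover_id.
rewrite (_ : x = 0); first exact: null0.
have /dist_rot/dist_rot d' := d.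
have [|z zE] := dist_weak_ker (w := fmap shift x) d'.
  by rewrite compNm -fmapM fx fmap_shift0 oppr0.
apply: shift_inj; rewrite fmap_shift0 -zE.
rewrite (_ : z = 0) ?compm0 //; apply: (leN_geN_hom (m := m)) geZ _.
  by rewrite leN_shift; apply: leN_mono leU; lia.
lia.
Qed.

(** Exactness of the long sequence at [H^m X]: an element killed by [f] is the
    image under the connecting map of an element of [H^(m - 1) Z], which comes
    from [Y]. *)
Lemma loc_inj_of_surj (m : int) X Y Z (f : hom X Y) (g : hom Y Z) h :
  dist f g h -> loc_surj (m - 1) g -> loc_inj m f.
Proof.
move=> d gs U x leU fx.
have /dist_rot/dist_rot d' := d.
have [|z zE] := dist_weak_ker (w := fmap shift x) d'.
  by rewrite compNm -fmapM fx fmap_shift0 oppr0.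
have [|V [e [y [[_ _ ce] yE]]]] := gs _ z; first by rewrite leN_shift subrK.
move=> W w geW; apply: shift_inj; rewrite fmap_shift0.
apply: ce; first by rewrite geN_shift subrK.
by rewrite fmapM -zE -!compA -yE (compA h) (dist_comp0' d) comp0m compm0.
Qed.

(** Covers are effective epimorphisms for maps into objects of [geN t m]: the
    cone of a cover is orthogonal to [geN t m], so its fiber lies in [leN t m]
    and serves as the object of relations. *)
Lemma cover_descent (m : int) U V E (e : hom V U) (a : hom V E) :
  cover m e -> geN t m E ->
  (forall F (k : hom F V), leN t m F -> e \oc k = 0 -> a \oc k = 0) ->
  exists s : hom U E, s \oc e = a.
Proof.
move=> [leV leU eU] geE ak.
have [F [k [h d]]] := exists_fiber e.
have leF : leN t m F.
  have /dist_rot d' := d; rewrite -[m](subrK 1) -leN_shift.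
  apply: leN_orth => Y y; rewrite subrK => geY.
  have /(dist_weak_coker (proj1 (dist_rot _ _ _) d')) [v <-] : y \oc h = 0.
    apply: eU => //; rewrite -compA (dist_comp0' d) compm0 //.
  rewrite (_ : v = 0) ?comp0m //; apply: (leN_geN_hom (m := m - 1)) geY _.
    by rewrite leN_shift subrK.
  lia.
exact: dist_weak_coker d (ak _ k leF (dist_comp0 d)).
Qed.

Lemma cover_of_loc_surj (m : int) V U (e : hom V U) :
  leN t m V -> leN t m U -> loc_surj m e -> cover m e.
Proof.
move=> leV leU es; split=> // W w geW we.
have [V' [e' [a [[_ _ ce'] aE]]]] := es _ (idm U) leU.
by apply: ce' => //; rewrite -(comp1m e') -aE compA we comp0m.
Qed.

Lemma loc_bij_heart_iso (m : int) X Y (f : hom X Y) : leN t m X -> geN t m X ->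
  leN t m Y -> geN t m Y -> loc_bij m f -> is_iso f.
Proof.
move=> leX geX leY geY [fs fi].
have cf : cover m f by exact: cover_of_loc_surj.
have [|s sf] := cover_descent (a := idm X) cf geX.
  by move=> F k leF fk; rewrite comp1m; apply: null_ge geX _; exact: fi.
exists s; split=> //; have [_ _ ce] := cf.
apply/eqP; rewrite -subr_eq0; apply/eqP/ce => //.
by rewrite compBl -compA sf compm1 comp1m subrr.
Qed.

End Truncations.

(** * Products and t-structures *)

(** Truncate just below the top degree: one piece lies in a single degree, the
    other has smaller amplitude. *)
Lemma devissage (C : triangulated_category) (t : tstructure C) (Q : C -> Prop) :
  (forall (X Y Z : C) (f : hom X Y) (g : hom Y Z) h,
     dist f g h -> Q X -> Q Z -> Q Y) ->
  forall (k : nat) (b : int) (X : C), leN t b X -> geN t (b - k%:Z) X ->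
  (forall (n : int) (Y : C), n <= b -> b - k%:Z <= n ->
     leN t n Y -> geN t n Y -> Q Y) -> Q X.
Proof.
move=> Qext; elim=> [|k IH] b X leX geX QH.
  by apply: (QH b) => //; [lia | rewrite subr0 in geX].
have [A [G [i [p [d [leA geG dX]]]]]] := trunc_dist t (b - 1) X.
rewrite subrK in geG.
have leG : leN t b G by apply: leN_cone dX _ leX; apply: leN_mono leA; lia.
have geA : geN t (b - 1 - k%:Z) A.
  apply: geN_fiber dX _ _; first by apply: geN_mono geX; lia.
  by apply: geN_mono geG; lia.
apply: Qext dX _ _; last by apply: (QH b) => //; lia.
by apply: IH leA geA _ => n Y nb bn; apply: QH; lia.
Qed.

Section Product.
Variables (C D E : triangulated_category) (B : exact_bifunctor C D E).
Variables (tC : tstructure C) (tD : tstructure D) (tE : tstructure E).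

Lemma bmap0l (X X' : C) (Y Y' : D) (g : hom Y Y') :
  bmap B (0 : hom X X') g = 0.
Proof. by apply: (addrI (bmap B 0 g)); rewrite -eb_addl !addr0. Qed.

Lemma act_zerol (X : C) (M : D) : is_zero X -> is_zero (B X M).
Proof.
by move=> zX; apply: idm0_is_zero; rewrite -bmap1 (proj1 (zX X) (idm X)) bmap0l.
Qed.

Hypothesis bC : bounded tC.
Hypothesis bD : bounded tD.
Hypothesis compat : forall X M, heart tC X -> heart tD M -> heart tE (B X M).

Lemma bounded_below (F : triangulated_category) (t : tstructure F) (b : int)
  (X : F) : bounded t -> exists k : nat, geN t (b - k%:Z) X.
Proof.
move=> [_ /(_ X)[a geX]]; exists `|b - a|%N; apply: geN_mono geX; lia.
Qed.

Lemma bounded_above (F : triangulated_category) (t : tstructure F) (a : int)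
  (X : F) : bounded t -> exists k : nat, leN t (a + k%:Z) X.
Proof.
move=> [/(_ X)[b leX] _]; exists `|b - a|%N; apply: leN_mono leX; lia.
Qed.

(** Moving the shifts out of the product reduces to [p = q = 0]. *)
Lemma act_heart (p q : int) (X : C) (M : D) :
  leN tC p X -> geN tC p X -> leN tD q M -> geN tD q M ->
  leN tE (p + q) (B X M) /\ geN tE (p + q) (B X M).
Proof.
rewrite !leNE !geNE => leX geX leM geM.
have [leXM geXM] : heart tE (B (shiftz p X) (shiftz q M)) by exact: compat.
have XM : isomorphic (B (shiftz p X) (shiftz q M)) (shiftz (p + q) (B X M)).
  by exists (act_shiftz B p q X M); exact: (bni_iso (act_shiftz B p q)).
by split; [exact: le0_iso XM leXM | exact: ge0_iso XM geXM].
Qed.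

Lemma act_leN (p q : int) (X : C) (M : D) :
  leN tC p X -> leN tD q M -> leN tE (p + q) (B X M).
Proof.
move=> leX leM.
have [[k geX] [l geM]] := (bounded_below p X bC, bounded_below q M bD).
apply: (devissage (Q := fun X => leN tE (p + q) (B X M))) leX geX _.
  by move=> X1 Y Z f g h d; exact: leN_ext (eb_distl B M d).
move=> n Y np _ leY geY.
apply: (devissage (Q := fun M => leN tE (p + q) (B Y M))) leM geM _.
  by move=> X1 M1 Z f g h d; exact: leN_ext (eb_distr B Y d).
move=> r N rq _ leM geM; apply: leN_mono (proj1 (act_heart leY geY leM geM)).
lia.
Qed.

Lemma act_geN (p q : int) (X : C) (M : D) :
  geN tC p X -> geN tD q M -> geN tE (p + q) (B X M).
Proof.
move=> geX geM.
have [[k leX] [l leM]] := (bounded_above p X bC, bounded_above q M bD).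
rewrite -[p](addrK k%:Z) in geX; rewrite -[q](addrK l%:Z) in geM.
apply: (devissage (Q := fun X => geN tE (p + q) (B X M))) leX geX _.
  by move=> X1 Y Z f g h d; exact: geN_ext (eb_distl B M d).
move=> n Y _ np leY geY.
apply: (devissage (Q := fun M => geN tE (p + q) (B Y M))) leM geM _.
  by move=> X1 M1 Z f g h d; exact: geN_ext (eb_distr B Y d).
move=> r N _ rq leM geM; apply: geN_mono (proj2 (act_heart leY geY leM geM)).
lia.
Qed.

End Product.

(** * Local decompositions *)

Section Decomposition.
Variables (C : triangulated_category) (t : tstructure C) (I : eqType).
Implicit Types (A Y Z U V : C) (P : I -> C) (s : seq I).

(** With [loc_indep], this says that [H^m Y] is the direct sum of the
    [H^m (P i)] with [i] in [s], through the maps [f i]. *)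
Definition loc_gen (m : int) s P Y (f : forall i, hom (P i) Y) : Prop :=
  forall U (y : hom U Y), leN t m U ->
  exists V (e : hom V U) (u : forall i, hom V (P i)),
    cover t m e /\ y \oc e = \sum_(i <- s) f i \oc u i.

Definition loc_indep (m : int) s P Y (f : forall i, hom (P i) Y) : Prop :=
  forall U (u : forall i, hom U (P i)), leN t m U ->
  null t m (\sum_(i <- s) f i \oc u i) -> forall i, i \in s -> null t m (u i).

Definition loc_decomp (m : int) s P Y (f : forall i, hom (P i) Y) : Prop :=
  loc_gen m s f /\ loc_indep m s f.

Lemma loc_decomp_nil (m : int) P Y (f : forall i, hom (P i) Y) :
  is_zero Y -> loc_decomp m [::] f.
Proof.
move=> zY; split=> // U y leU; exists U, (idm U), (fun=> 0); split.
  exact: cover_id.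
by rewrite big_nil; exact: (proj1 (zY U)).
Qed.

(** The summand of index [i] splits [H^m Y -> H^m Z], and [H^m A] is the
    kernel of that map because surjectivity of [b] in degree [m - 1] makes
    [a] injective on [H^m]. *)
Lemma loc_decomp_cons (m : int) (i : I) s P A Y Z
    (a : hom A Y) (b : hom Y Z) d (f : forall i, hom (P i) A)
    (g : forall i, hom (P i) Y) :
  dist a b d -> i \notin s -> (forall j, j \in s -> g j = a \oc f j) ->
  loc_decomp m s f -> loc_bij t m (b \oc g i) -> loc_surj t (m - 1) b ->
  loc_decomp m (i :: s) g.
Proof.
move=> dY is_ gE [fgen find] [bgs bgi] bs.
have sumE V (u : forall j, hom V (P j)) :
    \sum_(j <- s) g j \oc u j = a \oc \sum_(j <- s) f j \oc u j.
  rewrite comp_sumr; apply: eq_big_seq => j js.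
  by rewrite gE // compA.
split=> [U y leU|U u leU].
  have [V [e [v [ce vE]]]] := bgs U (b \oc y) leU.
  have [leV _ _] := ce.
  have [|x xE] := dist_weak_ker (w := y \oc e - g i \oc v) dY.
    by rewrite compBr !compA vE subrr.
  have [V' [e' [u [ce' uE]]]] := fgen V x leV.
  exists V', (e \oc e'), (dfwith u (v \oc e')); split; first exact: cover_comp.
  rewrite big_cons dfwith_in.
  rewrite (eq_big_seq (fun j => g j \oc u j)) => [|j js]; last first.
    rewrite dfwith_out //; apply: contraNneq is_ => ->.
    by [].
  by rewrite sumE -uE (compA a) xE compBl -!compA addrC subrK.
rewrite big_cons sumE => /(null_cover leU)[V [e [ce]]].
rewrite compDl => eq0.
have ui : null t m (u i).
  apply: cover_null (ce) _; apply: bgi; first by case: ce.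
  have : b \oc (g i \oc u i \oc e +
      a \oc (\sum_(j <- s) f j \oc u j) \oc e) = 0.
    by rewrite eq0 compm0.
  by rewrite compDr !compA (dist_comp0 dY) !comp0m addr0.
move=> j; rewrite inE => /predU1P[-> //|].
have [leV _ _] := ce.
have [V' [e' [ce' ui0]]] := null_cover leV (null_pre e ui).
have [leV' _ _] := ce'.
move: j; have cee := cover_comp ce ce'.
suff : forall j, j \in s -> null t m (u j \oc (e \oc e')).
  by move=> H j js; apply: cover_null cee (H j js).
apply: find => //.
have -> : \sum_(j <- s) f j \oc (u j \oc (e \oc e')) =
    (\sum_(j <- s) f j \oc u j) \oc (e \oc e').
  by rewrite comp_suml; apply: eq_bigr => j _; rewrite compA.
apply: (loc_inj_of_surj dY bs) => //.
have := congr1 (fun z => z \oc e') eq0; rewrite compDl comp0m -!compA.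
by rewrite (compA (u i)) ui0 compm0 add0r.
Qed.

Lemma loc_decomp_iso (m : int) s (P P' : I -> C) Y Y'
    (f : forall i, hom (P i) Y) (f' : forall i, hom (P' i) Y') (w : hom Y Y') :
  is_iso w ->
  (forall i, exists j : hom (P i) (P' i), is_iso j /\ f' i \oc j = w \oc f i) ->
  loc_decomp m s f -> loc_decomp m s f'.
Proof.
move=> wi jex [fgen find].
pose j i := projT1 (cid (jex i)).
have ji i : is_iso (j i) by rewrite /j; case: cid => ? [].
have jE i : f' i \oc j i = w \oc f i by rewrite /j; case: cid => ? [].
pose k i := projT1 (cid (ji i)).
have kj i : k i \oc j i = idm _ by rewrite /k; case: cid => ? [].
have jk i : j i \oc k i = idm _ by rewrite /k; case: cid => ? [].
have [w' [w'w ww']] := wi.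
have sumE V (u : forall i, hom V (P i)) :
    \sum_(i <- s) f' i \oc (j i \oc u i) = w \oc \sum_(i <- s) f i \oc u i.
  by rewrite comp_sumr; apply: eq_bigr => i _; rewrite compA jE compA.
split=> [U y leU|U u leU].
  have [V [e [u [ce uE]]]] := fgen U (w' \oc y) leU.
  exists V, e, (fun i => j i \oc u i); split=> //.
  by rewrite sumE -uE !compA ww' comp1m.
rewrite (eq_bigr (fun i => f' i \oc (j i \oc (k i \oc u i)))); last first.
  by move=> i _; rewrite (compA (j i)) jk comp1m.
rewrite sumE => nul i iS.
rewrite -(comp1m (u i)) -jk -compA; apply: null_post.
apply: (find U (fun i => k i \oc u i)) => //.
by rewrite -[X in null _ _ X]comp1m -w'w -compA; exact: null_post.
Qed.

End Decomposition.

Fixpoint downto (b : int) (k : nat) : seq int :=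
  if k is k'.+1 then b :: downto (b - 1) k' else [::].

Lemma mem_downto (b : int) (k : nat) (p : int) :
  (p \in downto b k) = (b - k%:Z < p <= b).
Proof.
elim: k b => [|k IH] b /=; first by rewrite in_nil; lia.
by rewrite inE IH; lia.
Qed.

Lemma downto_uniq (b : int) (k : nat) : uniq (downto b k).
Proof.
elim: k b => [|k IH] b //=; rewrite IH andbT mem_downto; lia.
Qed.

Section Kunneth.
Variables (C D E : triangulated_category) (B : exact_bifunctor C D E).
Variables (tC : tstructure C) (tD : tstructure D) (tE : tstructure E).
Hypothesis bC : bounded tC.
Hypothesis bD : bounded tD.
Hypothesis compat : forall X M, heart tC X -> heart tD M -> heart tE (B X M).

(** Factor through [G (x) N]: the fiber [X' (x) N] of the first map lies in
    degrees below [b + r], and the cone of the second, the product of [G] with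
    the cone of [y], in degrees above [b + r]. *)
Lemma top_slice_bij (b r : int) (X' X G X1 : C) (j : hom X' X) (g : hom X G) h
    (x : hom X1 X) (M N : D) (y : hom N M) :
  dist j g h -> leN tC (b - 1) X' -> geN tC b G ->
  is_iso x -> is_trunc tD r y ->
  loc_bij tE (b + r) (bmap B g (idm M) \oc bmap B x y).
Proof.
move=> dX leX' geG xi ty.
have [Z [z [w dM]]] := dist_cone y.
have geZ := trunc_cone ty dM.
rewrite -bmapM comp1m -[y in bmap B _ y]compm1 -[_ \oc x]comp1m bmapM.
apply: loc_bij_comp; last first.
  apply: loc_bij_cone (eb_distr B G dM) _.
  by rewrite -addrA; exact: (act_geN bC bD compat geG geZ).
rewrite -[idm N]comp1m bmapM; apply: loc_bij_comp.
  exact/loc_bij_iso/bmap_iso/is_iso_idm.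
apply: loc_bij_fiber (eb_distl B N dX) _.
by rewrite addrAC; exact: (act_leN bC bD compat leX' (proj1 ty)).
Qed.

(** Induction on the amplitude [k] of [X].  The truncations [A p] of [X] with
    [p < b] are also truncations of [A (b - 1)], to which the induction
    hypothesis applies. *)
Lemma kunneth_decomp (n : int) (M : D) (N : int -> D)
    (y : forall p, hom (N p) M) (ty : forall p, is_trunc tD (n - p) (y p))
    (k : nat) (b : int) (X : C) (A : int -> C) (x : forall p, hom (A p) X) :
  leN tC b X -> geN tC (b + 1 - k%:Z) X ->
  (forall p, p <= b -> is_trunc tC p (x p)) ->
  loc_decomp tE n (downto b k) (fun p => bmap B (x p) (y p)).
Proof.
elim: k b X x => [|k IH] b X x leX geX tx.
  apply: loc_decomp_nil; apply: act_zerol.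
  by apply: leN_geN_zero leX geX _; lia.
have txb := tx b (lexx b).
have tj : is_trunc tC (b - 1) (x (b - 1)) by apply: tx; lia.
have [G [g [h dX]]] := dist_cone (x (b - 1)).
have geG := trunc_cone tj dX; rewrite subrK in geG.
have xi := trunc_le_iso txb leX.
have lift p : exists x' : hom (A p) (A (b - 1)),
    p <= b - 1 -> x (b - 1) \oc x' = x p.
  case: (lerP p (b - 1)) => pb; last by exists 0.
  have [|x' x'E] := trunc_lift (x p) tj; last by exists x'.
  have pb1 : p <= b by lia.
  exact: leN_mono pb (proj1 (tx p pb1)).
pose x' p := projT1 (cid (lift p)).
have x'E p : p <= b - 1 -> x (b - 1) \oc x' p = x p.
  by rewrite /x'; case: cid.
(* The index p gives bijectivity in degree n - p + b: p = b is the summand to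
   split off, and p = b + 1 gives the surjectivity in degree n - 1. *)
have slice p := top_slice_bij dX (proj1 tj) geG xi (ty p).
apply: (loc_decomp_cons (a := bmap B (x (b - 1)) (idm M))
  (f := fun p => bmap B (x' p) (y p))) (eb_distl B M dX) _ _ _ _ _.
- by rewrite mem_downto; lia.
- move=> p; rewrite mem_downto => pb.
  by rewrite -bmapM comp1m x'E //; lia.
- apply: IH; first exact: (proj1 tj).
    apply: geN_orth => U u leU; apply: (trunc_inj tj).
      by apply: leN_mono leU; lia.
    by rewrite compm0; apply: leN_geN_hom leU geX _; lia.
  move=> p pb; split; first by apply: (proj1 (tx p _)); lia.
  have tp : is_trunc tC p (x p) by apply: tx; lia.
  move=> U u leU.
  have [v vE] := trunc_lift (x (b - 1) \oc u) tp leU.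
  have leU' : leN tC (b - 1) U by apply: leN_mono leU; lia.
  exists v; split.
    by apply: (trunc_inj tj) => //; rewrite compA x'E.
  move=> v' v'E; apply: (trunc_inj tp) => //.
  by rewrite vE -v'E compA x'E.
- by have := slice b; rewrite addrC subrK.
- apply: loc_surj_comp_last (proj1 _).
  by have := slice (b + 1); rewrite addrCA opprD addNKr => S; exact: S.
Qed.

End Kunneth.

(** * Cohomology objects *)

Section Cohomology.
Variables (C : triangulated_category) (t : tstructure C).
Implicit Types X Y Z U V : C.

Let L := tau_le0 t.
Let R := tau_ge0 t.

Lemma counit_trunc X : is_trunc t 0 (cor_counit L X).
Proof.
split; first by apply/leN0; exact: cor_in.
by move=> U u /leN0; exact: cor_univ.
Qed.

Lemma unit_ge X : geN t 0 (R X).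
Proof. by apply/geN0; exact: ref_in. Qed.

Lemma unit_lift X W (w : hom X W) : geN t 0 W ->
  exists v : hom (R X) W, v \oc ref_unit R X = w.
Proof. by move=> /geN0 geW; have [v [vE _]] := ref_univ R w geW; exists v. Qed.

Lemma unit_epi X W (v v' : hom (R X) W) : geN t 0 W ->
  v \oc ref_unit R X = v' \oc ref_unit R X -> v = v'.
Proof.
move=> /geN0 geW vE.
have [w [_ wu]] := ref_univ R (v \oc ref_unit R X) geW.
by rewrite -(wu v) // -(wu v').
Qed.

(** The reflection of [X] in [ge0] is the third object of its truncation
    triangle at level [-1], whose first object is invisible to [H^0]. *)
Lemma unit_loc_bij X : loc_bij t 0 (ref_unit R X).
Proof.
have [A [B [i [p [d [leA geB dX]]]]]] := trunc_dist t (0 - 1) X.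
rewrite subrK in geB; have [ps pi] := loc_bij_fiber dX leA.
have [g gE] := unit_lift p geB.
have [|g' g'E] := dist_weak_coker (w := ref_unit R X) dX.
  by apply: leN_geN_hom leA (unit_ge X) _; lia.
have g'g : g' \oc g = idm (R X).
  by apply: unit_epi (unit_ge X) _; rewrite -compA gE g'E comp1m.
split=> [U z leU|U x leU ux].
  have [V [e [x [ce xE]]]] := ps U (g \oc z) leU.
  by exists V, e, x; rewrite -g'E -compA xE !compA g'g comp1m.
by apply: pi; rewrite // -gE -compA ux compm0.
Qed.

Lemma counit_loc_bij X : loc_bij t 0 (cor_counit L X).
Proof.
have [Z [g [h d]]] := dist_cone (cor_counit L X).
exact: loc_bij_cone d (trunc_cone (counit_trunc X) d).
Qed.

Lemma H0_leN X : leN t 0 (L (R X)).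
Proof. by apply/leN0; exact: cor_in. Qed.

Lemma H0_geN X : geN t 0 (L (R X)).
Proof.
have [Z [g [h d]]] := dist_cone (cor_counit L (R X)).
have geZ := trunc_cone (counit_trunc _) d.
by apply: geN_fiber d (unit_ge X) (geN_mono _ geZ); lia.
Qed.

(** [L X] is [tau_le0 X] and [L (R X)] is [H^0 X], its top cohomology. *)
Definition top_coh X : hom (L X) (L (R X)) := fmap L (ref_unit R X).

Lemma top_coh_nat X Y (f : hom X Y) :
  fmap L (fmap R f) \oc top_coh X = top_coh Y \oc fmap L f.
Proof. by rewrite /top_coh -!fmapM ref_nat. Qed.

Lemma top_cohE X :
  cor_counit L (R X) \oc top_coh X = ref_unit R X \oc cor_counit L X.
Proof. by rewrite /top_coh -cor_nat. Qed.

Lemma top_coh_loc_bij X : loc_bij t 0 (top_coh X).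
Proof.
apply: loc_bij_cancel_l (counit_loc_bij (R X)) _; rewrite top_cohE.
exact: loc_bij_comp (counit_loc_bij X) (unit_loc_bij X).
Qed.

(** Bijectivity on [H^0] is not preserved by products, but having the fiber in
    [leN t (- 1)] is.  The truncation triangle of [L X] at level [-1] is the
    triangle sought, since its third object lies in the heart and is therefore
    isomorphic to [H^0 X]. *)
Lemma top_coh_dist X : exists F (k : hom F (L X)) h,
  dist k (top_coh X) h /\ leN t (- 1) F.
Proof.
have [F [B [k [b [d [leF geB dX]]]]]] := trunc_dist t (- 1) (L X).
rewrite addNr in geB.
have leLX : leN t 0 (L X) := proj1 (counit_trunc X).
have leB : leN t 0 B by apply: leN_cone dX _ leLX; apply: leN_mono leF; lia.
have [|v vE] := dist_weak_coker (w := top_coh X) dX.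
  by apply: leN_geN_hom leF (H0_geN X) _; lia.
have vi : is_iso v.
  apply: loc_bij_heart_iso leB geB (H0_leN X) (H0_geN X) _.
  apply: loc_bij_cancel_r (loc_bij_fiber (m := 0) dX leF) _.
  by rewrite vE; exact: top_coh_loc_bij.
have [w [wv vw]] := vi.
exists F, k, (d \oc w); split=> //.
apply: dist_iso dX => //; try exact: is_iso_idm.
- exact: vi.
- by rewrite comp1m compm1.
- by rewrite vE compm1.
- by rewrite fmap1 comp1m -compA wv compm1.
Qed.

Lemma H0_mono X U (v v' : hom U (L (R X))) : leN t 0 U ->
  cor_counit L (R X) \oc v = cor_counit L (R X) \oc v' -> v = v'.
Proof. by move=> leU; apply: (trunc_inj (counit_trunc _)). Qed.

(** A map out of [P] in [le0] defines a map on [H^0 P], which [c] identifies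
    with [H^0 Q]; for [Q] in the heart this is [Q] itself. *)
Lemma H0_factor P Q (c : hom P Q) Y (f : hom P Y) :
  leN t 0 P -> leN t 0 Q -> loc_bij t 0 c ->
  exists psi : hom Q (L (R Y)),
    cor_counit L (R Y) \oc psi \oc c = ref_unit R Y \oc f.
Proof.
move=> leP leQ [cs ci].
have [h hE] := trunc_lift (ref_unit R Y \oc f) (counit_trunc (R Y)) leP.
have cc := cover_of_loc_surj leP leQ cs.
have [|psi psiE] := cover_descent (a := h) cc (H0_geN Y).
  move=> F k leF ck; apply: null_ge (H0_geN Y) _.
  exact/null_post/ci.
by exists psi; rewrite -compA psiE.
Qed.

Lemma H0_factor_uniq P Q (c : hom P Q) Y (psi psi' : hom Q (L (R Y))) :
  leN t 0 P -> leN t 0 Q -> loc_bij t 0 c ->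
  cor_counit L (R Y) \oc psi \oc c = cor_counit L (R Y) \oc psi' \oc c ->
  psi = psi'.
Proof.
move=> leP leQ [cs _]; rewrite -!compA => /(H0_mono leP) E.
have [_ _ ce] := cover_of_loc_surj leP leQ cs.
apply/eqP; rewrite -subr_eq0; apply/eqP/ce; first exact: H0_geN.
by rewrite compBl E subrr.
Qed.

(** First transport the decomposition of [Y] along the [c i] to one of [H^0 Y]
    by the [psi i].  Then the identity of [H^0 Y], as a generalized element, is
    locally a sum of elements of the [Q i]; independence lets these descend to
    projections [p i] dual to the [psi i], which give the biproduct. *)
Lemma H0_coproduct (I : eqType) (s : seq I) (P Q : I -> C) Y
    (c : forall i, hom (P i) (Q i)) (f : forall i, hom (P i) Y)
    (psi : forall i, hom (Q i) (L (R Y))) :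
  uniq s ->
  (forall i, [/\ leN t 0 (P i), leN t 0 (Q i), geN t 0 (Q i) &
     loc_bij t 0 (c i)]) ->
  (forall i, cor_counit L (R Y) \oc psi i \oc c i = ref_unit R Y \oc f i) ->
  (forall i, i \notin s -> is_zero (Q i)) ->
  loc_decomp t 0 s f ->
  forall Z (g : forall i, hom (Q i) Z),
  exists! h : hom (L (R Y)) Z, forall i, h \oc psi i = g i.
Proof.
move=> us H psiE zQ [fgen find] Z g.
have sumE V (v : forall i, hom V (P i)) :
    cor_counit L (R Y) \oc (\sum_(i <- s) psi i \oc (c i \oc v i)) =
    ref_unit R Y \oc (\sum_(i <- s) f i \oc v i).
  by rewrite !comp_sumr; apply: eq_bigr => i _; rewrite !compA psiE.
(* Independence for psi: lift the u i along the c i on a common cover. *)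
have indep U (u : forall i, hom U (Q i)) : leN t 0 U ->
    \sum_(i <- s) psi i \oc u i = 0 -> forall i, i \in s -> u i = 0.
  move=> leU u0.
  have lift (r : seq I) : exists V (e : hom V U) (v : forall i, hom V (P i)),
      cover t 0 e /\ forall i, i \in r -> c i \oc v i = u i \oc e.
    elim: r => [|i r [V [e [v [ce vE]]]]].
      by exists U, (idm U), (fun=> 0); split; first exact: cover_id.
    have [leV _ _] := ce; have [_ _ _ [cs _]] := H i.
    have [V' [e' [w [ce' wE]]]] := cs V (u i \oc e) leV.
    exists V', (e \oc e'), (dfwith (fun i => v i \oc e') w).
    split; first exact: cover_comp.
    move=> j; case: (eqVneq i j) => [<- _|ij].
      by rewrite dfwith_in wE compA.
    rewrite inE eq_sym (negPf ij) dfwith_out // => jr.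
    by rewrite compA vE // compA.
  have [V [e [v [ce vE]]]] := lift s.
  have [leV _ eU] := ce.
  have nul : null t 0 (\sum_(i <- s) f i \oc v i).
    move=> W w geW; have [w' <-] := unit_lift w geW.
    rewrite -compA -sumE (eq_big_seq (fun i => psi i \oc u i \oc e)).
      by rewrite -comp_suml u0 comp0m !compm0.
    by move=> i iS; rewrite vE // compA.
  move=> i iS; have [_ _ geQ _] := H i; apply: eU => //.
  by rewrite -vE //; apply: null_ge geQ (null_post _ _); exact: find nul i iS.
have [V [e [pie [ce pieE]]]] : exists V (e : hom V (L (R Y)))
    (u : forall i, hom V (Q i)),
    cover t 0 e /\ e = \sum_(i <- s) psi i \oc u i.
  have [V [e [y [ce yE]]]] :=
    proj1 (unit_loc_bij Y) _ (cor_counit L (R Y)) (H0_leN Y).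
  have [leV _ _] := ce.
  have [V' [e' [v [ce' vE]]]] := fgen V y leV.
  have cee := cover_comp ce ce'; have [leV' _ _] := cee.
  exists V', (e \oc e'), (fun i => c i \oc v i); split=> //.
  by apply: (H0_mono leV'); rewrite sumE -vE !compA yE.
have piex i : exists p : hom (L (R Y)) (Q i), i \in s -> p \oc e = pie i.
  case iS: (i \in s); last by exists 0.
  have [_ _ geQ _] := H i.
  have [|p pE] := cover_descent (a := pie i) ce geQ; last by exists p.
  move=> F k leF ek; apply: (indep F (fun i => pie i \oc k)) => //.
  rewrite -[RHS]ek [in RHS]pieE comp_suml.
  by apply: eq_bigr => j _; rewrite compA.
pose p i := projT1 (cid (piex i)).
have pE i : i \in s -> p i \oc e = pie i by rewrite /p; case: cid.
have sum1 : \sum_(i <- s) psi i \oc p i = idm (L (R Y)).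
  have [_ _ eH] := ce.
  apply/eqP; rewrite -subr_eq0; apply/eqP/eH; first exact: H0_geN.
  rewrite compBl comp1m comp_suml {2}pieE.
  apply/eqP; rewrite subr_eq0; apply/eqP; apply: eq_big_seq => i iS.
  by rewrite -compA pE.
(* The dfwith family is the Kronecker delta, with value 1 only at i = j. *)
have ppsi j : j \in s -> forall i, i \in s ->
    p i \oc psi j = dfwith (fun i => 0 : hom (Q j) (Q i)) (idm (Q j)) i.
  move=> jS i iS; apply/eqP; rewrite -subr_eq0; apply/eqP.
  have [_ leQ _ _] := H j.
  apply: (indep (Q j) (fun i => p i \oc psi j -
    dfwith (fun i => 0 : hom (Q j) (Q i)) (idm (Q j)) i)) => //.
  under eq_bigr => k _ do rewrite compBr compA.
  rewrite sumrB -comp_suml sum1 comp1m (bigD1_seq j) //= dfwith_in compm1.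
  rewrite big1 ?addr0 ?subrr // => k kj.
  by rewrite dfwith_out 1?eq_sym // compm0.
exists (\sum_(i <- s) g i \oc p i); split=> [j|h hE].
  case jS: (j \in s); last first.
    have [_ zj] := zQ j (negbT jS) Z.
    by rewrite (zj (g j)); exact: zj.
  rewrite comp_suml (bigD1_seq j) //= -compA ppsi // dfwith_in compm1.
  rewrite big_seq_cond big1 ?addr0 // => k /andP[kS kj].
  by rewrite -compA ppsi // dfwith_out 1?eq_sym // compm0.
rewrite -[RHS]compm1 -sum1 comp_sumr; apply: eq_bigr => i _.
by rewrite compA hE.
Qed.

End Cohomology.

(** * The Kunneth maps *)

Section KunnethMaps.
Variables (C D E : triangulated_category) (B : exact_bifunctor C D E).
Variables (tC : tstructure C) (tD : tstructure D) (tE : tstructure E).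
Hypothesis bC : bounded tC.
Hypothesis bD : bounded tD.
Hypothesis compat : forall X M, heart tC X -> heart tD M -> heart tE (B X M).

Let LC := tau_le0 tC.
Let LD := tau_le0 tD.
Let LE := tau_le0 tE.
Let RE := tau_ge0 tE.

(** The cohomology in degree zero is [tau_le0 tau_ge0] without a shift, so this
    applies to [shiftz p X] and [shiftz q M] for all [p] and [q]. *)
Lemma top_coh_act (X : C) (M : D) :
  [/\ leN tE 0 (B (LC X) (LD M)),
      leN tE 0 (B (cohomology tC 0 X) (cohomology tD 0 M)),
      geN tE 0 (B (cohomology tC 0 X) (cohomology tD 0 M)) &
      loc_bij tE 0 (bmap B (top_coh tC X) (top_coh tD M))].
Proof.
have leX := proj1 (counit_trunc tC X); have leM := proj1 (counit_trunc tD M).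
have [leHX geHX] := (H0_leN tC X, H0_geN tC X).
have [leHM geHM] := (H0_leN tD M, H0_geN tD M).
split.
- by rewrite -[0]addr0; exact: (act_leN bC bD compat leX leM).
- by rewrite -[0]addr0; exact: (act_leN bC bD compat leHX leHM).
- by rewrite -[0]addr0; exact: (act_geN bC bD compat geHX geHM).
have [F [k [h [dF leF]]]] := top_coh_dist tC X.
have [G [l [i [dG leG]]]] := top_coh_dist tD M.
rewrite -[top_coh tC X]comp1m -[top_coh tD M]compm1 bmapM.
apply: loc_bij_comp.
  apply: loc_bij_fiber (eb_distl B (LD M) dF) _.
  exact: (act_leN bC bD compat leF leM).
apply: loc_bij_fiber (eb_distr B _ dG) _.
exact: (act_leN bC bD compat leHX leG).
Qed.

(** With [cancel_shifts] this identifies [X[p] (x) M[q]] with [X (x) M[n]] in a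
    form that is natural in [X] and [M[n]] separately, so that it can be
    evaluated on their truncations. *)
Lemma unshift_right (p q n : int) (pq : p + q == n) :
  nat_iso (@shiftz D q) (compF (shiftz (- p)) (shiftz n)).
Proof.
rewrite -(eqP pq); have := shiftz_comp D (- p) (p + q).
by rewrite addKr; exact: nat_iso_sym.
Qed.

Lemma cancel_shifts (p : int) :
  binat_iso (preB B (shiftz p) (shiftz (- p))) (postB (shiftz 0) B).
Proof. by have := act_shiftz B p (- p); rewrite addrN. Qed.

Section Piece.
Variables (p q n : int) (pq : p + q == n).

Definition piece_to (X : C) (M : D) :
    hom (B (LC (shiftz p X)) (LD (shiftz q M))) (B X (shiftz n M)) :=
  cancel_shifts p X (shiftz n M) \oc
    bmap B (cor_counit LC (shiftz p X))
           (unshift_right pq M \oc cor_counit LD (shiftz q M)).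

Lemma piece_to_nat (X X' : C) (M M' : D) (f : hom X X') (g : hom M M') :
  bmap B f (fmap (shiftz n) g) \oc piece_to X M =
  piece_to X' M' \oc bmap B (fmap LC (fmap (shiftz p) f))
                            (fmap LD (fmap (shiftz q) g)).
Proof.
apply: square_comp; last first.
  exact: (bni_nat (cancel_shifts p) f (fmap (shiftz n) g)).
rewrite /= -!bmapM; congr (bmap B _ _); first exact: cor_nat.
by apply: square_comp (cor_nat _ _) _; exact: (ni_nat (unshift_right pq) g).
Qed.

Definition piece_map (X : C) (M : D) :
    hom (B (LC (shiftz p X)) (LD (shiftz q M))) (shiftz n (B X M)) :=
  act_shiftz_r B n X M \oc piece_to X M.

Lemma piece_map_nat (X X' : C) (M M' : D) (f : hom X X') (g : hom M M') :
  fmap (shiftz n) (bmap B f g) \oc piece_map X M =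
  piece_map X' M' \oc bmap B (fmap LC (fmap (shiftz p) f))
                             (fmap LD (fmap (shiftz q) g)).
Proof.
apply: square_comp (piece_to_nat f g) _.
exact: (bni_nat (act_shiftz_r B n) f g).
Qed.

Definition piece_top (X : C) (M : D) :=
  bmap B (top_coh tC (shiftz p X)) (top_coh tD (shiftz q M)).

Lemma kunneth_exists (X : C) (M : D) :
  exists psi : hom (B (cohomology tC p X) (cohomology tD q M))
                   (cohomology tE n (B X M)),
  cor_counit LE (RE (shiftz n (B X M))) \oc psi \oc piece_top X M =
  ref_unit RE (shiftz n (B X M)) \oc piece_map X M.
Proof.
have [leP leQ _ cb] := top_coh_act (shiftz p X) (shiftz q M).
exact: (H0_factor (piece_map X M) leP leQ cb).
Qed.

Definition kunneth_map X M := projT1 (cid (kunneth_exists X M)).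

Lemma kunneth_mapE X M :
  cor_counit LE (RE (shiftz n (B X M))) \oc kunneth_map X M \oc piece_top X M =
  ref_unit RE (shiftz n (B X M)) \oc piece_map X M.
Proof. by rewrite /kunneth_map; case: cid. Qed.

Lemma kunneth_map_nat (X X' : C) (M M' : D) (f : hom X X') (g : hom M M') :
  fmap (cohomology tE n) (bmap B f g) \oc kunneth_map X M =
  kunneth_map X' M' \oc bmap B (fmap (cohomology tC p) f)
                               (fmap (cohomology tD q) g).
Proof.
have [leP leQ _ cb] := top_coh_act (shiftz p X) (shiftz q M).
apply: (H0_factor_uniq leP leQ cb).
have sq : bmap B (fmap (cohomology tC p) f) (fmap (cohomology tD q) g) \oc
    piece_top X M = piece_top X' M' \oc
    bmap B (fmap LC (fmap (shiftz p) f)) (fmap LD (fmap (shiftz q) g)).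
  by rewrite /piece_top -!bmapM /= !top_coh_nat.
rewrite -[in RHS]compA -[in RHS]compA sq.
rewrite [in RHS]compA [in RHS]compA kunneth_mapE.
rewrite -[in RHS]compA -piece_map_nat [in RHS]compA -ref_nat -[in RHS]compA.
by rewrite -kunneth_mapE !compA cor_nat.
Qed.

End Piece.

(** Choose truncations [A p] of [X] and [N p] of [M[n]] whose shifts are the
    truncations used to define the pieces.  The map [A p (x) N p -> X (x) M[n]]
    is then isomorphic to [piece_map], and [kunneth_decomp] applies.  Outside
    the amplitude of [X] the truncation of [X[p]] has no cohomology in degree
    zero, so the summand vanishes. *)
Lemma kunneth_coproduct (n : int) (X : C) (M : D) (Z : E)
    (g : forall p : int,
       hom (B (cohomology tC p X) (cohomology tD (n - p) M)) Z)
    (e : forall p : int, p + (n - p) == n) :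
  exists! h : hom (cohomology tE n (B X M)) Z,
    forall p, h \oc kunneth_map (e p) X M = g p.
Proof.
have [[b leX] [a geX]] : (exists b, leN tC b X) /\ (exists a, geN tC a X).
  by split; [exact: (proj1 bC) | exact: (proj2 bC)].
(* The amplitude: X lies in degrees from b + 1 - k to b. *)
pose k := absz (b + 1 - a)%R.
have geX' : geN tC (b + 1 - k%:Z) X by apply: geN_mono geX; lia.
have Aex p : exists A (x : hom A X) (al : hom (shiftz p A) (LC (shiftz p X))),
    [/\ is_iso al, is_trunc tC p x &
        cor_counit LC (shiftz p X) \oc al = fmap (shiftz p) x].
  have [A [x [al [ali tx alE]]]] :=
    trunc_unshift (counit_trunc tC (shiftz p X)).
  by exists A, x, al; split=> //; rewrite add0r in tx.
have Nex p : exists N (y : hom N (shiftz n M))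
    (be : hom (shiftz (- p) N) (LD (shiftz (n - p) M))),
    [/\ is_iso be, is_trunc tD (0 - p) y &
        (unshift_right (e p) M \oc cor_counit LD (shiftz (n - p) M)) \oc be =
        fmap (shiftz (- p)) y].
  apply: trunc_unshift; split; first exact: (proj1 (counit_trunc tD _)).
  have [v [vK Kv]] := ni_iso (unshift_right (e p)) M.
  move=> U u leU; have [w wE] := trunc_lift (v \oc u) (counit_trunc tD _) leU.
  exists w; split; first by rewrite -compA wE compA Kv comp1m.
  move=> w' w'E; apply: (trunc_inj (counit_trunc tD _) leU).
  by rewrite wE -w'E !compA vK comp1m.
pose A p := projT1 (cid (Aex p)).
pose x p : hom (A p) X := projT1 (cid (projT2 (cid (Aex p)))).
have AE p : exists al : hom (shiftz p (A p)) (LC (shiftz p X)),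
    [/\ is_iso al, is_trunc tC p (x p) &
        cor_counit LC (shiftz p X) \oc al = fmap (shiftz p) (x p)].
  exact: (projT2 (cid (projT2 (cid (Aex p))))).
pose N p := projT1 (cid (Nex p)).
pose y p : hom (N p) (shiftz n M) := projT1 (cid (projT2 (cid (Nex p)))).
have NE p : exists be : hom (shiftz (- p) (N p)) (LD (shiftz (n - p) M)),
    [/\ is_iso be, is_trunc tD (0 - p) (y p) &
        (unshift_right (e p) M \oc cor_counit LD (shiftz (n - p) M)) \oc be =
        fmap (shiftz (- p)) (y p)].
  exact: (projT2 (cid (projT2 (cid (Nex p))))).
have dec0 : loc_decomp tE 0 (downto b k) (fun p => bmap B (x p) (y p)).
  apply: (kunneth_decomp bC bD compat _ leX geX') => p.
    by have [? []] := NE p.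
  by have [? []] := AE p.
apply: (H0_coproduct (s := downto b k) (f := fun p => piece_map (e p) X M)
  (c := fun p => piece_top p (n - p) X M)).
- exact: downto_uniq.
- by move=> p; exact: top_coh_act.
- by move=> p; exact: kunneth_mapE.
- move=> p; rewrite mem_downto => pb.
  have [leP leQ geQ [cs _]] := top_coh_act (shiftz p X) (shiftz (n - p) M).
  have leL : leN tC (- 1) (LC (shiftz p X)).
    case: (lerP p b) => [pb'|bp].
      apply/leN_zero/(trunc_ge_zero (counit_trunc tC (shiftz p X))).
      by rewrite geN_shiftz; apply: geN_mono geX; lia.
    have leXp : leN tC (- 1) (shiftz p X).
      by rewrite leN_shiftz; apply: leN_mono leX; lia.
    apply: leN_iso (leXp); apply: isomorphic_sym.
    exists (cor_counit LC (shiftz p X)).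
    by apply: trunc_le_iso (counit_trunc tC _) _; apply: leN_mono leXp; lia.
  have leP1 : leN tE (- 1 + 0) (B (LC (shiftz p X)) (LD (shiftz (n - p) M))).
    exact: (act_leN bC bD compat leL (proj1 (counit_trunc tD _))).
  have [_ _ ce] := cover_of_loc_surj leP leQ cs.
  apply/idm0_is_zero/ce => //.
  by apply: leN_geN_hom leP1 geQ _.
apply: loc_decomp_iso (dec0); first exact: (bni_iso (act_shiftz_r B n) X M).
move=> p; have [al [ali _ alE]] := AE p; have [be [bei _ beE]] := NE p.
have [s [sK Ks]] := bni_iso (cancel_shifts p) (A p) (N p).
exists (bmap B al be \oc s); split.
  apply: is_iso_compose; first exact: bmap_iso.
  by exists (cancel_shifts p (A p) (N p)).
rewrite /piece_map /piece_to -!compA; congr (_ \oc _).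
rewrite (compA (bmap B _ _)) -bmapM alE beE compA.
have := bni_nat (cancel_shifts p) (x p) (y p); rewrite /= => <-.
by rewrite -compA Ks compm1.
Qed.

Lemma bidegree_complement (n p : int) : p + (n - p) == n.
Proof. by rewrite addrC subrK. Qed.

Lemma kunneth_bidegree_coproduct (n : int) (X : C) (M : D) (Z : E)
    (g : forall pq : bidegree n,
       hom (B (cohomology tC (val pq).1 X) (cohomology tD (val pq).2 M)) Z) :
  exists! h : hom (cohomology tE n (B X M)) Z,
    forall pq : bidegree n, h \oc kunneth_map (valP pq) X M = g pq.
Proof.
pose b p : bidegree n := exist _ (p, n - p) (bidegree_complement n p).
have bE (pq : bidegree n) : pq = b (val pq).1.
  apply: val_inj; case: pq => -[p q] /= /eqP <-.
  by rewrite addrAC subrr add0r.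
have [h [hE hu]] := kunneth_coproduct (fun p => g (b p)) (fun p => valP (b p)).
exists h; split=> [pq|h' h'E]; first by rewrite (bE pq); exact: hE.
by apply: hu => p; exact: (h'E (b p)).
Qed.

End KunnethMaps.

(* The family is not assumed to have a coproduct: its existence is part of the
   conclusion, and the isomorphism is asserted for every choice of coproducts,
   which makes the right-hand side a bifunctor in X and M. *)
Theorem proposition3p3
    (T : monoidal_triangulated) (K : module_category T)
    (t : tstructure T) (t' : tstructure K)
    (t_bounded : bounded t) (t_compatible : compatible t)
    (t'_bounded : bounded t') (act_t_compatible : act_compatible t t')
    (n : int) :
  (forall (X : T) (M : K),
     inhabited (coproduct (fun pq : bidegree n => kunneth_family t t' n pq X M)))
  /\
  (forall S : (forall (X : T) (M : K),
                 coproduct (fun pq : bidegree n => kunneth_family t t' n pq X M)),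
     inhabited (binat_iso (cohomology_act t' n)
                          (coprodB (kunneth_family t t' n) S))).
Proof.
pose psi (pq : bidegree n) X M :=
  kunneth_map t_bounded t'_bounded act_t_compatible (valP pq) X M.
have univ X M := kunneth_bidegree_coproduct t_bounded t'_bounded
  act_t_compatible (n := n) (X := X) (M := M).
have psi_nat pq X X' M M' (f : hom X X') (g : hom M M') :
    fmap (cohomology t' n) (bmap (act K) f g) \oc psi pq X M =
    psi pq X' M' \oc bmap (kunneth_family t t' n pq) f g.
  exact: kunneth_map_nat.
split=> [X M|S].
  pose cp Z g := projT1 (cid (univ X M Z g)).
  have cpE Z g : forall pq, cp Z g \oc psi pq X M = g pq.
    by rewrite /cp; case: cid => h [].
  constructor; refine (@Coproduct K _ (fun pq => kunneth_family t t' n pq X M)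
    (cohomology t' n (act K X M)) (fun pq => psi pq X M) cp cpE _).
  move=> Z h h' hh'; have [k [_ ku]] := univ X M Z (fun pq => h \oc psi pq X M).
  by rewrite -(ku h) // -(ku h') // => pq; rewrite -(hh' pq).
pose cp X M := projT1 (cid (univ X M (S X M) (inj (S X M)))).
have cpE X M pq : cp X M \oc psi pq X M = inj (S X M) pq.
  by have [cE _] := projT2 (cid (univ X M (S X M) (inj (S X M)))); exact: cE.
have psi_epi X M Z (h h' : hom (cohomology t' n (act K X M)) Z) :
    (forall pq, h \oc psi pq X M = h' \oc psi pq X M) -> h = h'.
  move=> hh'; have [k [_ ku]] := univ X M Z (fun pq => h \oc psi pq X M).
  by rewrite -(ku h) // -(ku h') // => pq; rewrite -(hh' pq).
constructor.
refine (@BinatIso _ _ _ (cohomology_act t' n)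
  (coprodB (kunneth_family t t' n) S) cp _ _) => [X M|X X' M M' f g].
  exists (copair (S X M) (fun pq => psi pq X M)); split.
    by apply: psi_epi => pq; rewrite -compA cpE (copairK (S X M)) comp1m.
  apply: (copair_uniq (c := S X M)) => pq.
  by rewrite -compA (copairK (S X M)) cpE comp1m.
apply: psi_epi => pq; rewrite -!compA cpE psi_nat compA cpE.
by rewrite /= (copairK (S X M)).
Qed.
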